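(* Let $u\in\mathcal{C}^1_p$ be an incident direction at $p\in\eta$, and let $\Pi^1_u:=u^{\perp_{\mathcal{C}^1}}\cap T_p\eta$. ''Refracted direction'' means refracted direction associated with $u$. When $u$ is $\mathcal{C}^1$-transverse to $\eta$ and $\mathcal{C}^2_p\cap Q^2_p\neq\emptyset$: (A) If $T_p\eta$ is $\mathcal{C}^2$-timelike, then: (i) if $\Pi^1_u$ is $\mathcal{C}^2$-spacelike, there exists a unique refracted direction, necessarily transverse to $\eta$; (ii) if $\Pi^1_u$ is $\mathcal{C}^2$-lightlike, there exists a unique refracted direction, necessarily tangent to $\eta$; (iii) if $\Pi^1_u$ is $\mathcal{C}^2$-timelike, there are no refracted directions. (B) If $T_p\eta$ is $\mathcal{C}^2$-lightlike, then $\Pi^1_u$ cannot be $\mathcal{C}^2$-timelike and: (i) if $\Pi^1_u$ is $\mathcal{C}^2$-spacelike, there are exactly two refracted directions, necessarily one tangent to $\eta$ and the other transverse; (ii) if $\Pi^1_u$ is $\mathcal{C}^2$-lightlike, there exists a unique refracted direction, necessarily tangent to $\eta$. (C) If $T_p\eta$ is $\mathcal{C}^2$-spacelike, there are exactly two refracted directions, necessarily transverse to $\eta$. Otherwise, when $u^{\perp_{\mathcal{C}^1}}=T_p\eta$ or $\mathcal{C}^2_p\cap Q^2_p=\emptyset$, there exists a refracted direction (necessarily unique and tangent to $\eta$) if and only if $T_p\eta$ is $\mathcal{C}^2$-lightlike.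
   Context: Cone structures. A cone structure on a manifold $Q$ is a (smooth, embedded) hypersurface $\mathcal{C}$ of $TQ\setminus\mathbf{0}$ such that for each $p\in Q$: (i) $\mathcal{C}$ is transverse to the fibers of $TQ$, i.e. for $v\in\mathcal{C}_p:=T_pQ\cap\mathcal{C}$, $T_v(T_pQ)+T_{(p,v)}\mathcal{C}=T_{(p,v)}(TQ)$; (ii) $\mathcal{C}_p$ is conic ($v\in\mathcal{C}_p\Rightarrow\lambda v\in\mathcal{C}_p$ for all $\lambda>0$), salient ($v\in\mathcal{C}_p\Rightarrow -v\notin\mathcal{C}_p$), is the boundary in $T_pQ\setminus\{0\}$ of an open convex subset $A_p\subset T_pQ\setminus\{0\}$, and is (non-radially) strongly convex: the second fundamental form of $\mathcal{C}_p$ as an affine hypersurface of $T_pQ$ is positive semi-definite (with respect to an inner direction pointing to $A_p$) with radical at each $v\in\mathcal{C}_p$ spanned by the radial direction of $v$. Causality. A vector $v\in T_pQ$ is timelike if $v\in A_p$, lightlike if $v\in\mathcal{C}_p$, causal if $v\in A_p\cup\mathcal{C}_p$, spacelike if neither $v$ nor $-v$ is causal. A linear subspace $\Pi\subset T_pQ$ is timelike if it contains a timelike vector, lightlike if it is tangent to $\mathcal{C}_p$ along one radial direction $v\in\mathcal{C}_p$ (i.e. $v\in\Pi\subset T_v\mathcal{C}_p$), spacelike if all its vectors are spacelike. The prefix ''$\mathcal{C}$-'' specifies the cone structure. Orthogonality. For $v\in\mathcal{C}_p$, $v^{\perp_{\mathcal{C}}}:=T_v\mathcal{C}_p$ (a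 hyperplane of $T_pQ$); $v\perp_{\mathcal{C}}\Pi$ means $\Pi\subset v^{\perp_{\mathcal{C}}}$. Setting. $Q$ is a smooth manifold of dimension $n+1\ge3$; $\eta$ is a smooth embedded hypersurface dividing $Q$ into two open subsets $Q_1,Q_2$ whose closures $\overline{Q}_1,\overline{Q}_2$ (with union $Q$) are smooth manifolds with common boundary $\eta$. $\mathcal{C}^1,\mathcal{C}^2$ are cone structures on $\overline{Q}_1,\overline{Q}_2$ (smoothly extendable slightly beyond $\eta$), not necessarily matching on $\eta$. Directions. For $p\in\eta$, $Q^1_p,Q^2_p\subset T_pQ$ are the two open half-spaces of $T_pQ\setminus T_p\eta$, $Q^\mu_p$ being the one on the $Q_\mu$-side. A direction $v$ means the half-ray $\{\lambda v:\lambda>0\}$ (uniqueness and counting of directions is up to positive rescaling). A vector $v\in T_pQ$ is transverse to $\eta$ if $v\notin T_p\eta$; $r\in\mathcal{C}^\mu_p$ is $\mathcal{C}^\mu$-transverse to $\eta$ if $r^{\perp_{\mathcal{C}^\mu}}\ne T_p\eta$. For $r\in\mathcal{C}^\mu_p$ put $\Pi^\mu_r:=r^{\perp_{\mathcal{C}^\mu}}\cap T_p\eta$. An incident direction at $p$ is $u\in\mathcal{C}^1_p$ with $u\in Q^2_p\cup T_p\eta$. A refracted direction associated with $u$ is $v\in\mathcal{C}^2_p$ with $v\in Q^2_p\cup T_p\eta$ and $\Pi^1_u\subset\Pi^2_v$ (i.e. $v\perp_{\mathcal{C}^2}\Pi^1_u$). *)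

(* Defs.v *)
From HB Require Import structures.
From mathcomp Require Import all_boot all_order all_algebra.
From mathcomp Require Import all_classical all_reals all_analysis.

Set Implicit Arguments.
Unset Strict Implicit.
Unset Printing Implicit Defensive.

Import Order.TTheory GRing.Theory Num.Theory.
Import numFieldNormedType.Exports.

Local Open Scope classical_set_scope.
Local Open Scope ring_scope.

Section NormedSpaces.
Context {R : realType}.

(* Meant for [U] open and [V] finite-dimensional, where it is the usual C^k. *)
Fixpoint Ck_on (V W : normedModType R) (k : nat) (U : set V) (f : V -> W) :
    Prop :=
  match k with
  | 0 => forall x, U x -> {for x, continuous f}
  | k'.+1 => (forall x, U x -> differentiable f x) /\
             forall v, Ck_on k' U (fun x => 'D_v f x)
  end.

Definition smooth_on (V W : normedModType R) (U : set V) (f : V -> W) : Prop :=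
  forall k, Ck_on k U f.

Context {E : normedModType R}.

(* [f] is a local equation of [S] near [x], regular at [x]. *)
Definition local_equation (S : set E) (x : E) (f : E -> R) : Prop :=
  exists U : set E,
    [/\ open_nbhs x U,
        smooth_on U f,
        forall y, U y -> (S y <-> f y = 0)
      & exists v, 'd f x v != 0].

Definition hypersurface (S : set E) : Prop :=
  forall x, S x -> exists f, local_equation S x f.

(* The tangent hyperplane T_x S; it does not depend on the local equation. *)
Definition tangent_space (S : set E) (x : E) : set E :=
  [set v | exists2 f, local_equation S x f & 'd f x v = 0].

(* [h] is the second fundamental form at [x] of the affine hypersurface [S]
   with respect to the transverse direction [xi], i.e. D_X Y = nabla_X Y +
   h(X, Y) xi (Gauss formula) with nabla_X Y tangent to [S], for D the flat
   connection of [E].  Only the values of [h] on T_x S are constrained. *)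
Definition second_fundamental_form (S : set E) (x xi : E) (h : E -> E -> R) :
    Prop :=
  forall (U : set E) (X : E) (Y : E -> E),
    open_nbhs x U -> smooth_on U Y ->
    (forall y, U y -> S y -> tangent_space S y (Y y)) ->
    tangent_space S x X ->
    tangent_space S x ('D_X Y x - h X (Y x) *: xi).

(* The conditions imposed on a single fiber [C] of a cone structure, [A] being
   the open convex set bounded by [C]. *)
Record strong_cone (C A : set E) : Prop := StrongCone {
  strong_cone_conic : forall v (a : R), C v -> 0 < a -> C (a *: v);
  strong_cone_salient : forall v, C v -> ~ C (- v);
  strong_cone_open : open A;
  strong_cone_neq0 : ~ A 0;
  strong_cone_convex : convex_set A;
  strong_cone_boundary : C = (closure A `\` A°) `\ 0;
  strong_cone_strongly_convex : forall v, C v ->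
    exists (xi : E) (h : E -> E -> R),
      [/\ ~ tangent_space C v xi,
          \forall t \near 0^'+, A (v + t *: xi),
          second_fundamental_form C v xi h,
          forall X, tangent_space C v X -> 0 <= h X X
        & forall X, tangent_space C v X ->
            ((forall Y, tangent_space C v Y -> h X Y = 0) <->
             exists a : R, X = a *: v)]
}.

End NormedSpaces.

Record smoothManifold (R : realType) (m : nat) := SmoothManifold {
  point_space :> topologicalType;
  manifold_hausdorff : hausdorff_space point_space;
  manifold_second_countable : @second_countable point_space;
  chart : Type;
  cdom : chart -> set point_space;
  cmap : chart -> point_space -> 'rV[R]_m;
  cinv : chart -> 'rV[R]_m -> point_space;
  cdom_open : forall c, open (cdom c);
  cimage_open : forall c, open (cmap c @` cdom c);
  cmapK : forall c p, cdom c p -> cinv c (cmap c p) = p;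
  cmap_continuous : forall c p, cdom c p -> {for p, continuous (cmap c)};
  cinv_continuous : forall c x, (cmap c @` cdom c) x ->
    {for x, continuous (cinv c)};
  transition_smooth : forall c d,
    smooth_on (cmap c @` (cdom c `&` cdom d)) (cmap d \o cinv c);
  chart_at : point_space -> chart;
  chart_at_dom : forall p, cdom (chart_at p) p
}.

(* T_pQ is 'rV[R]_m for every [p]: a tangent vector at [p] is given by its
   coordinates in the preferred chart [chart_at p]; [coord c p] converts them
   to coordinates in the chart [c]. *)

Section Manifolds.
Context {R : realType} {m : nat} {Q : smoothManifold R m}.

Definition coord (c : chart Q) (p : Q) (v : 'rV[R]_m) : 'rV[R]_m :=
  'd (cmap c \o cinv (chart_at p)) (cmap (chart_at p) p) v.

Definition smooth_fun (U : set Q) (f : Q -> R) : Prop :=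
  forall c : chart Q, smooth_on (cmap c @` (U `&` cdom c)) (f \o cinv c).

Definition differential (f : Q -> R) (p : Q) (v : 'rV[R]_m) : R :=
  'd (f \o cinv (chart_at p)) (cmap (chart_at p) p) v.

Definition mlocal_equation (eta : set Q) (p : Q) (f : Q -> R) : Prop :=
  exists U : set Q,
    [/\ open_nbhs p U,
        smooth_fun U f,
        forall q, U q -> (eta q <-> f q = 0)
      & exists v, differential f p v != 0].

Definition mhypersurface (eta : set Q) : Prop :=
  forall p, eta p -> exists f, mlocal_equation eta p f.

Definition mtangent_space (eta : set Q) (p : Q) : set 'rV[R]_m :=
  [set v | exists2 f, mlocal_equation eta p f & differential f p v = 0].

(* [f] presents [D] near [p] as a smooth domain {f >= 0} with boundary
   [eta] = {f = 0}. *)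
Definition boundary_equation (D eta : set Q) (p : Q) (f : Q -> R) : Prop :=
  mlocal_equation eta p f /\ \forall q \near p, D q <-> 0 <= f q.

Definition domain_with_boundary (D eta : set Q) : Prop :=
  forall p, eta p -> exists f, boundary_equation D eta p f.

Record divides (eta Q1 Q2 : set Q) : Prop := Divides {
  divides_hypersurface : mhypersurface eta;
  divides_open1 : open Q1;
  divides_open2 : open Q2;
  divides_disjoint : Q1 `&` Q2 = set0;
  divides_complement : ~` eta = Q1 `|` Q2;
  divides_closure : closure Q1 `|` closure Q2 = setT;
  divides_domain1 : domain_with_boundary (closure Q1) eta;
  divides_domain2 : domain_with_boundary (closure Q2) eta
}.

(* The open half-space of T_pQ \ T_p eta on the side of the open set [O]. *)
Definition side_halfspace (eta O : set Q) (p : Q) : set 'rV[R]_m :=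
  [set v | exists2 f, boundary_equation (closure O) eta p f
                    & 0 < differential f p v].

(* The hypersurface of the tangent bundle with fibers [C p], over [U], read in
   the bundle chart induced by [c]. *)
Definition bundle_chart_set (U : set Q) (C : Q -> set 'rV[R]_m)
    (c : chart Q) : set ('rV[R]_m * 'rV[R]_m) :=
  [set z | exists p v, [/\ U p, cdom c p, C p v & z = (cmap c p, coord c p v)]].

Record cone_structure_on (U : set Q) (C A : Q -> set 'rV[R]_m) : Prop :=
  ConeStructureOn {
  cone_on_neq0 : forall p v, U p -> C p v -> v != 0;
  cone_on_hypersurface : forall c, hypersurface (bundle_chart_set U C c);
  cone_on_transverse : forall c z, bundle_chart_set U C c z ->
    forall t : 'rV[R]_m * 'rV[R]_m,
    exists (w : 'rV[R]_m) (s : 'rV[R]_m * 'rV[R]_m),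
      tangent_space (bundle_chart_set U C c) z s /\ t = (0, w) + s;
  cone_on_fiber : forall p, U p -> strong_cone (C p) (A p)
}.

(* A cone structure on [D] (a smooth domain with boundary), smoothly extendable
   to an open neighborhood of [D]; the values of [cone] and [inner] outside [D]
   are irrelevant. *)
Record coneStructure (D : set Q) := ConeStructure {
  cone : Q -> set 'rV[R]_m;
  inner : Q -> set 'rV[R]_m;
  cone_extendable : exists (U : set Q) (C A : Q -> set 'rV[R]_m),
    [/\ open U, D `<=` U, cone_structure_on U C A
      & forall p, D p -> C p = cone p /\ A p = inner p]
}.

Section Causality.
Context {D : set Q} (C : coneStructure D) (p : Q).

Definition causal (v : 'rV[R]_m) : Prop := inner C p v \/ cone C p v.

Definition spacelike (v : 'rV[R]_m) : Prop := ~ causal v /\ ~ causal (- v).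

Definition perp (v : 'rV[R]_m) : set 'rV[R]_m := tangent_space (cone C p) v.

(* Causal character of a linear subspace of T_pQ; the zero vector is spacelike,
   since neither [inner] nor [cone] contains it. *)
Definition timelike_subspace (P : set 'rV[R]_m) : Prop :=
  exists v, P v /\ inner C p v.

Definition lightlike_subspace (P : set 'rV[R]_m) : Prop :=
  exists v, [/\ cone C p v, P v & P `<=` perp v].

Definition spacelike_subspace (P : set 'rV[R]_m) : Prop := P `<=` spacelike.

End Causality.

Section Refraction.
Context (eta Q1 Q2 : set Q).
Context (C1 : coneStructure (closure Q1)) (C2 : coneStructure (closure Q2)).
Context (p : Q).

Definition perp_trace {D : set Q} (C : coneStructure D) (r : 'rV[R]_m) :
    set 'rV[R]_m :=
  perp C p r `&` mtangent_space eta p.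

Definition incident (u : 'rV[R]_m) : Prop :=
  cone C1 p u /\ (side_halfspace eta Q2 p u \/ mtangent_space eta p u).

Definition refracted (u v : 'rV[R]_m) : Prop :=
  [/\ cone C2 p v,
      side_halfspace eta Q2 p v \/ mtangent_space eta p v
    & perp_trace C1 u `<=` perp_trace C2 v].

End Refraction.

End Manifolds.

Section Directions.
Context {R : realType} {m : nat}.
Implicit Types (P : set 'rV[R]_m) (v w z : 'rV[R]_m).

Definition same_direction v w : Prop := exists2 a : R, 0 < a & w = a *: v.

Definition at_most_one_direction P : Prop :=
  forall v w, P v -> P w -> same_direction v w.

Definition unique_direction P : Prop :=
  (exists v, P v) /\ at_most_one_direction P.

Definition exactly_two_directions P : Prop :=
  exists v w, [/\ P v, P w, ~ same_direction v w
    & forall z, P z -> same_direction v z \/ same_direction w z].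

End Directions.

(* Main.v *)
(* At p, the hyperplane T_p eta is the kernel of a linear form phi, positive on
   the Q_2-side, and u^perp is the kernel of a linear form l; when these differ,
   Pi_u is the intersection of the two kernels. A vector v of C^2_p is refracted
   iff phi v >= 0 and the supporting hyperplane of A^2_p at v belongs to the
   pencil spanned by phi and l. Projecting A^2_p by (phi, l) to the plane, one
   is left with the boundary rays of a planar convex cone lying in {phi >= 0}.
   A boundary ray with phi > 0 is found by minimizing l / phi over a compact
   base of the closed cone, and each boundary ray lifts to a single direction
   because strong convexity makes every supporting hyperplane touch the cone
   along one ray only. *)

(* The case distinction comes from the condition under which [l / phi] attains its minimum on
   [phi > 0]: the closed cone minus the origin must satisfy [l > 0] wherever [phi = 0]. If [T_p eta]
   is timelike or lightlike and the trace is spacelike, exactly one of [l] and [- l] meets this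
   condition, which gives one transverse direction; in the lightlike case the contact ray of
   [T_p eta] is a second, tangent one. If [T_p eta] is spacelike, the condition holds vacuously for
   both signs, and the minimum and the maximum of [l / phi] give two directions. A trace containing
   a vector of the cone needs no minimization: that vector lies in the tangent hyperplane of every
   refracted vector, and strict convexity decides.

   Two definitions shape the preparatory work. Tangent spaces and sides are existential in a local
   equation, so each is first reduced to the kernel or sign of a single form. Strong convexity
   speaks of a second fundamental form tested on smooth tangential fields, so a suitable field has
   to be produced before it says anything about segments. *)
Require Import Defs.
From mathcomp Require Import all_boot all_order all_algebra.
From mathcomp Require Import all_classical all_reals all_analysis.
From mathcomp Require Import ring lra.

Import Order.TTheory GRing.Theory Num.Theory.
Import numFieldNormedType.Exports.

Set Implicit Arguments.
Unset Strict Implicit.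
Unset Printing Implicit Defensive.

Local Open Scope classical_set_scope.
Local Open Scope ring_scope.

(** * Linear identities in modules *)

(* Identities between vectors reduce to identities between the scalar
   coefficients of each atom, as [ring] does not apply to modules. *)
Section LinearExpressions.
Context {K : comNzRingType} {V : lmodType K}.

Inductive lexp :=
  | LVar of nat | LZero | LAdd of lexp & lexp | LOpp of lexp
  | LScale of K & lexp.

Fixpoint leval (env : seq V) e : V :=
  match e with
  | LVar i => env`_i
  | LZero => 0
  | LAdd e1 e2 => leval env e1 + leval env e2
  | LOpp e1 => - leval env e1
  | LScale c e1 => c *: leval env e1
  end.

(** [eqn] instead of [==] lets [cbn] decide the comparison of literal indices, which leaves pure
    ring equations. *)
Fixpoint lcoef e (i : nat) : K :=
  match e with
  | LVar j => if eqn i j then 1 else 0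
  | LZero => 0
  | LAdd e1 e2 => lcoef e1 i + lcoef e2 i
  | LOpp e1 => - lcoef e1 i
  | LScale c e1 => c * lcoef e1 i
  end.

Fixpoint lcoef_eq n e1 e2 : Prop :=
  if n is n'.+1 then lcoef e1 n' = lcoef e2 n' /\ lcoef_eq n' e1 e2 else True.

Lemma levalE env e :
  leval env e = \sum_(i < size env) lcoef e i *: env`_i.
Proof.
elim: e => [j||e1 IH1 e2 IH2|e1 IH|c e1 IH] /=.
- have [jn|nj] := ltnP j (size env).
    rewrite (bigD1 (Ordinal jn))//= big1 ?addr0; last first.
      move=> i ij; rewrite eqnE ifN ?scale0r//.
    by rewrite eqnE eqxx scale1r.
  rewrite nth_default// big1// => i _; rewrite eqnE ifN ?scale0r//.
  by rewrite neq_ltn (leq_trans (ltn_ord i)).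
- by rewrite big1// => i _; rewrite scale0r.
- by rewrite IH1 IH2 -big_split; apply: eq_bigr => i _; rewrite scalerDl.
- by rewrite IH -sumrN; apply: eq_bigr => i _; rewrite scaleNr.
- by rewrite IH scaler_sumr; apply: eq_bigr => i _; rewrite scalerA.
Qed.

Lemma leval_eq env e1 e2 : lcoef_eq (size env) e1 e2 ->
  leval env e1 = leval env e2.
Proof.
move=> H; rewrite !levalE; apply: eq_bigr => -[i /= ilt] _; congr (_ *: _).
elim: (size env) H ilt => //= n IH [Hn /IH Hlt].
by rewrite ltnS leq_eqVlt => /predU1P[->|/Hlt].
Qed.

End LinearExpressions.

Ltac lmem x l :=
  lazymatch l with
  | nil => constr:(false)
  | x :: _ => constr:(true)
  | _ :: ?l' => lmem x l'
  end.

Ltac lindex x l :=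
  lazymatch l with
  | x :: _ => constr:(O)
  | _ :: ?l' => let n := lindex x l' in constr:(S n)
  end.

Ltac latoms t l :=
  lazymatch t with
  | (?a + ?b)%R => let l1 := latoms a l in latoms b l1
  | (- ?a)%R => latoms a l
  | (_ *: ?a)%R => latoms a l
  | 0%R => l
  | _ => lazymatch lmem t l with true => l | false => constr:(t :: l) end
  end.

Ltac lreify t l :=
  lazymatch t with
  | (?a + ?b)%R =>
      let u := lreify a l in let v := lreify b l in open_constr:(LAdd u v)
  | (- ?a)%R => let u := lreify a l in open_constr:(LOpp u)
  | (?c *: ?a)%R => let u := lreify a l in open_constr:(LScale c u)
  | 0%R => open_constr:(LZero)
  | _ => let n := lindex t l in open_constr:(LVar n)
  end.

Ltac lmodule :=
  lazymatch goal with
  | |- @eq ?T ?a ?b =>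
    let l := latoms a (@nil T) in let l' := latoms b l in
    let u := lreify a l' in let v := lreify b l' in
    apply: (@leval_eq _ _ l' u v);
    cbn [lcoef_eq lcoef size eqn]; repeat split
  end.

(** * Tangent spaces of hypersurfaces *)

Lemma diff_expansion (R : realType) (E F : normedModType R) (f : E -> F) x :
  differentiable f x -> forall e : R, 0 < e -> exists2 d : R, 0 < d &
  forall h, `|h| < d -> `|f (x + h) - f x - 'd f x h| <= e * `|h|.
Proof.
move=> fx e e0.
have /eqaddoP/(_ _ e0)/nbhs_ballP[d /= d0 H] := diff_locally fx.
exists d => // h hd; have := H h.
rewrite -ball_normE /ball_ /= sub0r normrN => /(_ hd).
rewrite !fctE [h + x]addrC.
by rewrite opprD addrA.
Qed.

Lemma open_nbhs_ball (R : realType) (E : normedModType R) (U : set E) x :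
  open U -> U x -> exists2 d : R, 0 < d & forall h, `|h| < d -> U (x + h).
Proof.
move=> oU Ux; have : nbhs x U by exact: open_nbhs_nbhs.
rewrite -nbhs_ballE => -[d d0 H]; exists d => // h hd; apply: H.
by rewrite -ball_normE /= opprD addrA subrr sub0r normrN.
Qed.

Lemma linear_bound (R : realType) (E F : normedModType R)
    (f : {linear E -> F}) : continuous f ->
  exists2 k : R, 0 < k & forall h, `|f h| <= k * `|h|.
Proof.
move=> /linear_bounded_continuous/linear_boundedP[M [_ MP]].
exists (`|M| + 1); first by rewrite ltr_wpDl.
by move=> h; apply: MP; rewrite (le_lt_trans (ler_norm _))// ltrDl.
Qed.

Section TangentCone.
Context {R : realType} {E : normedModType R}.
Implicit Types (S : set E) (x v : E) (f : E -> R).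

(* It depends on [S] alone: the choice of a local equation is irrelevant. *)
Definition tangent_cone S x : set E := [set v |
  forall e : R, 0 < e -> exists2 d : R, 0 < d &
  forall t, 0 < t < d -> exists2 y, S y & `|y - (x + t *: v)| <= e * t].

Lemma local_equation_diff S x f : local_equation S x f ->
  differentiable f x.
Proof. by case=> U [[_ Ux] /(_ 1) [/(_ x Ux)]]. Qed.

Lemma local_equation_root S x f : local_equation S x f -> S x -> f x = 0.
Proof. by case=> U [[_ Ux] _ /(_ x Ux) [? _] _]. Qed.

(** Near [x + t *: v] the function [f] changes sign along a direction [w] with ['d f x w > 0], so
    the intermediate value theorem yields a point of [S] there. *)
Lemma ker_sub_tangent_cone S x f v : local_equation S x f -> S x ->
  'd f x v = 0 -> tangent_cone S x v.
Proof.
move=> eqf Sx fv0 e e0; have fx := local_equation_diff eqf.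
have fx0 := local_equation_root eqf Sx.
have [U [[oU Ux] sf SU [w0 fw0]]] := eqf.
have [w fw] : exists w, 0 < 'd f x w.
  have [lt0|gt0|/eqP] := ltgtP ('d f x w0) 0; last by rewrite (negbTE fw0).
    by exists (- w0); rewrite linearN oppr_gt0.
  by exists w0.
(* The root is sought at [x + t *: v + s *: w] with |s| at most [a * t]; this [a] makes the
   displacement at most [e * t]. *)
pose a := e / (`|w| + 1).
have w1 : 0 < `|w| + 1 by rewrite ltr_wpDl.
have a0 : 0 < a by rewrite divr_gt0.
have aw : a * `|w| <= e.
  by rewrite /a mulrAC ler_pdivrMr// ler_pM2l// lerDl.
pose M := `|v| + e.
have M0 : 0 < M by rewrite ltr_wpDl.
(* On increments of norm at most [t * M] the error is then half of [a * t * 'd f x w], too small to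
   spoil the signs at the ends of the segment. *)
have e10 : 0 < a * 'd f x w / (2 * M) by rewrite divr_gt0// mulr_gt0.
have [d1 d10 exp] := diff_expansion fx e10.
have [d2 d20 ball] := open_nbhs_ball oU Ux.
exists (Num.min d1 d2 / M) => [|t /andP[t0 td]].
  by rewrite divr_gt0// lt_min d10.
have tM : t * M < Num.min d1 d2 by rewrite -ltr_pdivlMr.
pose h (s : R) := t *: v + s *: w.
have hM (s : R) : `|s| <= a * t -> `|h s| <= t * M.
  move=> s1; rewrite (le_trans (ler_normD _ _))// !normrZ (gtr0_norm t0).
  rewrite /M mulrDr lerD2l (le_trans (ler_wpM2r _ s1))//.
  by rewrite mulrAC mulrC ler_wpM2l// ltW.
have hd1 (s : R) : `|s| <= a * t -> `|h s| < d1.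
  by move=> /hM /le_lt_trans; apply; rewrite (lt_le_trans tM)// ge_min lexx.
have hd2 (s : R) : `|s| <= a * t -> `|h s| < d2.
  move=> /hM /le_lt_trans; apply.
  by rewrite (lt_le_trans tM)// ge_min lexx orbT.
have at0 : 0 < a * t by rewrite mulr_gt0.
have bnd (s : R) : `|s| <= a * t ->
    `|f (x + h s) - s * 'd f x w| <= a * t * 'd f x w / 2.
  move=> s1; have := exp _ (hd1 _ s1); rewrite fx0 subr0.
  have -> : 'd f x (h s) = s * 'd f x w.
    by rewrite linearD !linearZ /= fv0 scaler0 add0r.
  move=> /le_trans; apply.
  apply: le_trans (ler_wpM2l _ (hM _ s1)) _.
    by rewrite ltW// divr_gt0// mulr_gt0.
  by rewrite le_eqVlt; apply/orP; left; apply/eqP; field; rewrite gt_eqF.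
have cg : {within `[- (a * t), a * t], continuous (fun s => f (x + h s))}.
  apply: continuous_in_subspaceT => s /set_mem /=.
  rewrite in_itv /= -ler_norml => s1.
  apply: (@continuous_comp _ _ _ (fun s => x + h s) f).
    apply: continuousD; first exact: cst_continuous.
    apply: continuousD; first exact: cst_continuous.
    by apply: continuousZl; exact: cvg_id.
  by apply: (sf 0); apply: ball; exact: hd2.
have [s sI fs] : exists2 s, s \in `[- (a * t), a * t] & f (x + h s) = 0.
  apply: IVT cg _; first lra.
  have aa : `|a * t| <= a * t by rewrite gtr0_norm.
  have aaN : `|- (a * t)| <= a * t by rewrite normrN.
  have := bnd _ aaN; have := bnd _ aa.
  have fat : 0 < a * t * 'd f x w by rewrite mulr_gt0.
  rewrite mulNr !ler_norml => /andP[h3 h4] /andP[h1 h2].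
  rewrite ge_min le_max; apply/andP; split; apply/orP; [left|right]; lra.
have s1 : `|s| <= a * t by move: sI; rewrite in_itv /= -ler_norml.
exists (x + h s).
  by apply/SU => //; apply: ball; exact: hd2.
rewrite /h addrA [_ + s *: w]addrC addrK normrZ.
apply: le_trans (ler_wpM2r _ s1) _ => //.
by rewrite mulrAC ler_wpM2r// ltW.
Qed.

(** [f] vanishes at [x] and at points of [S] close to [x + t *: v], so the linear term
    [t *: 'd f x v] is bounded by the sum of two errors of order [t]. *)
Lemma tangent_cone_sub_ker S x f v : local_equation S x f -> S x ->
  tangent_cone S x v -> 'd f x v = 0.
Proof.
move=> eqf Sx tv; have fx := local_equation_diff eqf.
have fx0 := local_equation_root eqf Sx.
have [U [[oU Ux] sf SU _]] := eqf.
apply/eqP; rewrite -normr_le0; apply/ler_addgt0Pl => e e0; rewrite addr0.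
have [k k0 kP] := linear_bound (diff_continuous fx).
pose e1 := e / (k + `|v| + 2); pose M := `|v| + 2.
have v2 : 0 < k + `|v| + 2 by rewrite ltr_wpDl// addr_ge0// ltW.
have e10 : 0 < e1 by rewrite divr_gt0.
(* The bound 1 gives |h| at most t(|v| + 1); the bound [e1] controls the image of [h - t *: v] under
   the differential. *)
pose e2 := Num.min 1 e1.
have e20 : 0 < e2 by rewrite lt_min ltr01.
have [d1 d10 exp] := diff_expansion fx e10.
have [d2 d20 ball] := open_nbhs_ball oU Ux.
have [d3 d30 /=] := tv _ e20.
have M0 : 0 < M by rewrite ltr_wpDl.
pose d := Num.min (Num.min d1 d2 / M) d3.
have d0 : 0 < d by rewrite lt_min divr_gt0// lt_min d10.
pose t := d / 2.
have t0 : 0 < t by rewrite divr_gt0.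
have td : t < d by rewrite /t ltr_pdivrMr// ltr_pMr// ltr1n.
case/(_ t); first by rewrite t0 (lt_le_trans td)// ge_min lexx orbT.
move=> y Sy yt.
pose h := y - x.
have tM : t * M < Num.min d1 d2.
  by rewrite -ltr_pdivlMr// (lt_le_trans td)// ge_min lexx.
have htv : `|h - t *: v| <= e2 * t by rewrite /h -addrA -opprD.
have hM : `|h| <= t * (`|v| + 1).
  rewrite -(subrK (t *: v) h) (le_trans (ler_normD _ _))// normrZ gtr0_norm//.
  rewrite mulrDr mulr1 [leRHS]addrC lerD2r (le_trans htv)//.
  by rewrite ler_piMl ?(ltW t0)// /e2 ge_min lexx.
have hM2 : `|h| < t * M by rewrite (le_lt_trans hM)// ltr_pM2l// ltrD2l ltr1n.
have f0 : f (x + h) = 0.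
  rewrite /h addrC subrK; apply/SU => //.
  rewrite -(subrK x y) addrC; apply: ball.
  by rewrite (lt_trans hM2)// (lt_le_trans tM)// ge_min lexx orbT.
have := exp h; rewrite (lt_trans hM2); last first.
  by rewrite (lt_le_trans tM)// ge_min lexx.
rewrite f0 fx0 subrr sub0r normrN => /(_ isT) dfh.
have := kP (h - t *: v); rewrite linearB linearZ /= => dfhv.
have e21 : e2 <= e1 by rewrite /e2 ge_min lexx orbT.
have : `|t *: 'd f x v| <= t * e.
  rewrite -(subKr ('d f x h) (t *: 'd f x v)) (le_trans (ler_normB _ _))//.
  apply: le_trans (lerD dfh dfhv) _.
  apply: le_trans (_ : e1 * (t * (`|v| + 1)) + k * (e1 * t) <= _).
    apply: lerD; first by rewrite ler_wpM2l// ltW.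
    rewrite ler_wpM2l ?(ltW k0)//.
    by rewrite (le_trans htv)// ler_wpM2r// ltW.
  rewrite [leRHS](_ : _ = e1 * t * (k + `|v| + 2)); last first.
    by rewrite /e1; field; rewrite gt_eqF.
  have := mulr_gt0 e10 t0; nra.
by rewrite normrZ gtr0_norm// ler_pM2l.
Qed.

(** The kernels of any two local equations agree, both being the tangent cone; this removes the
    existential from [tangent_space]. *)
Lemma tangent_spaceE S x f : local_equation S x f -> S x ->
  tangent_space S x = [set v | 'd f x v = 0].
Proof.
move=> eqf Sx; apply/seteqP; split=> [v [g eqg gv]|v fv] /=; last by exists f.
exact: tangent_cone_sub_ker eqf Sx (ker_sub_tangent_cone eqg Sx gv).
Qed.

Lemma tangent_space_cone S x v : hypersurface S -> S x ->
  tangent_space S x v <-> tangent_cone S x v.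
Proof.
move=> hS Sx; have [f eqf] := hS _ Sx; rewrite (tangent_spaceE eqf)//; split.
  exact: ker_sub_tangent_cone eqf Sx.
exact: tangent_cone_sub_ker eqf Sx.
Qed.

End TangentCone.

(** * Open convex sets *)

Section LinearForms.
Context {R : realType} {E : normedModType R} (l : {linear E -> R}).

Lemma lformD x y : l (x + y) = l x + l y. Proof. exact: linearD. Qed.
Lemma lformN x : l (- x) = - l x. Proof. exact: linearN. Qed.
Lemma lformZ (a : R) x : l (a *: x) = a * l x. Proof. exact: linearZ. Qed.
Lemma lform0 : l 0 = 0. Proof. exact: linear0. Qed.

Definition lformE := (lformD, lformN, lformZ, lform0).

End LinearForms.
Arguments lformE {R E} l.

Section OpenConvex.
Context {R : realType} {E : normedModType R} (A : set E).
Hypotheses (oA : open A) (cA : convex_set A).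
Implicit Types (a b v w x y : E) (t s : R).

Lemma convex_setP x y t : A x -> A y -> 0 <= t <= 1 -> A (x + t *: (y - x)).
Proof.
move=> Ax Ay /andP[t0 t1].
have /set_mem := @cA _ _ (Itv01 t0 t1) (mem_set Ay) (mem_set Ax).
congr A; rewrite [LHS](_ : _ = t *: y + (1 - t) *: x)//; lmodule; ring.
Qed.

Lemma closure_ballP (B : set E) b : closure B b <->
  forall e : R, 0 < e -> exists2 y, B y & `|y - b| < e.
Proof.
rewrite closureEnbhs; split => [cb e e0|H C D BC /nbhs_ballP[e /= e0 eD]].
  have [y [By]] := cb _ _ (fun=> id) (nbhsx_ballx b _ e0).
  by rewrite -ball_normE /= distrC => yb; exists y.
have [y By yb] := H e e0.
by exists y; split; [exact: BC|apply: eD; rewrite -ball_normE /= distrC].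
Qed.

(** The limit point [b] is replaced by a nearby [b'] in [A], and [a] is shifted to [a'] inside its
    ball so that the point at parameter [t] does not move. *)
Lemma convex_segment_interior a b t : A a -> closure A b -> 0 < t <= 1 ->
  A (b + t *: (a - b)).
Proof.
move=> Aa cb /andP[t0 t1]; have [r r0 rA] := open_nbhs_ball oA Aa.
have [b' Ab' bb'] := (closure_ballP A b).1 cb _ (mulr_gt0 t0 r0).
pose a' := a + ((1 - t) / t) *: (b - b').
have Aa' : A a'.
  apply: rA; rewrite normrZ distrC ger0_norm ?divr_ge0 ?subr_ge0 ?(ltW t0)//.
  rewrite mulrAC ltr_pdivrMr//.
  have : 0 <= `|b' - b| by []; nra.
have -> : b + t *: (a - b) = b' + t *: (a' - b').
  by rewrite /a'; lmodule; field; rewrite gt_eqF.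
by apply: convex_setP => //; rewrite (ltW t0).
Qed.

Lemma closure_segment a x : (forall t, 0 < t < 1 -> A (x + t *: (a - x))) ->
  closure A x.
Proof.
move=> H; apply/closure_ballP => e e0.
have n0 : 0 < `|a - x| + 1 by rewrite ltr_wpDl.
pose t := Num.min (e / (`|a - x| + 1)) (1 / 2).
have t0 : 0 < t by rewrite lt_min !divr_gt0.
have te : t * (`|a - x| + 1) <= e by rewrite -ler_pdivlMr// ge_min lexx.
exists (x + t *: (a - x)).
  by apply: H; rewrite t0/= gt_min orbC ltr_pdivrMr// mul1r ltr1n.
rewrite addrC addrA addNr add0r normrZ gtr0_norm//.
by rewrite (lt_le_trans _ te)// ltr_pM2l// ltrDl.
Qed.

(** Pushing both ends towards a point of [A] puts them in [A], where convexity applies;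
    [closure_segment] lets the push tend to zero. *)
Lemma closure_convex x y t : A !=set0 -> closure A x -> closure A y ->
  0 <= t <= 1 -> closure A (x + t *: (y - x)).
Proof.
move=> [a Aa] cx cy t01; apply: (@closure_segment a) => s /andP[s0 s1].
have s01 : 0 < s <= 1 by rewrite s0 ltW.
have Ax := convex_segment_interior Aa cx s01.
have Ay := convex_segment_interior Aa cy s01.
have := convex_setP Ax Ay t01.
by congr A; lmodule; ring.
Qed.

(** [t] is the first exit parameter, the minimum of a compact set; all earlier points lie in [A], so
    the exit point is in the closure. *)
Lemma boundary_segment a b : A a -> ~ A b -> exists2 t, 0 < t <= 1 &
  (closure A `\` A) (a + t *: (b - a)).
Proof.
move=> Aa Ab; pose z t := a + t *: (b - a).
have zc : continuous z.
  move=> t; apply: (@continuousD _ _ _ (fun=> a) (fun s => s *: (b - a))).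
    exact: cst_continuous.
  by apply: continuousZl; exact: cvg_id.
pose B := `[0, 1]%classic `&` (z @^-1` (~` A)).
have B1 : B 1.
  by split; rewrite /= ?in_itv/= ?ler01 ?lexx// /z scale1r addrC subrK.
have cB : compact B.
  apply: (subclosed_compact _ (@segment_compact R 0 1)); last by move=> ? [].
  apply: closedI; first exact: interval_closed.
  by apply: closed_comp => [? _|]; [exact: zc|exact: open_closedC].
have [t /set_mem[/=]] : exists2 t, t \in B & forall s, s \in B -> t <= s.
  apply: (@compact_EVT_min _ _ id B _ cB); first by exists 1.
  by apply: continuous_subspaceT => ?; exact: cvg_id.
rewrite in_itv /= => /andP[t0 t1] Bt tmin.
have {}t0 : 0 < t.
  rewrite lt_neqAle t0 andbT; apply/negP => /eqP t0'.
  by apply: Bt; rewrite /z -t0' scale0r addr0.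
exists t; first by rewrite t0.
split=> //; apply: (@closure_segment a) => s /andP[s0 s1].
apply: contrapT => nA; have : (1 - s) * t \in B.
  apply/mem_set; split => /=; last first.
    by move: nA; congr (~ A _); rewrite /z; lmodule; ring.
  rewrite in_itv/=; nra.
by move=> /tmin; nra.
Qed.

Lemma convex_nonvanishing (l : {linear E -> R}) : (forall a, A a -> l a != 0) ->
  (forall a, A a -> 0 < l a) \/ (forall a, A a -> l a < 0).
Proof.
move=> l0; have [[a Aa la]|H] := pselect (exists2 a, A a & 0 < l a); last first.
  right=> a Aa; rewrite lt_neqAle l0//= leNgt; apply/negP => la.
  by apply: H; exists a.
left=> b Ab; rewrite lt_neqAle eq_sym l0//= leNgt; apply/negP => lb.
pose t := l a / (l a - l b).
have d0 : 0 < l a - l b by lra.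
have := l0 (a + t *: (b - a)); rewrite !lformE.
have -> : l a + t * (l b - l a) = 0 by rewrite /t; field; rewrite gt_eqF.
rewrite eqxx => H; have // : false; apply: H; apply: convex_setP => //.
by rewrite divr_ge0 ?(ltW d0) ?(ltW la)//= ler_pdivrMr// mul1r; lra.
Qed.

Lemma closure_ge0 (l : {linear E -> R}) : continuous l ->
  (forall a, A a -> 0 <= l a) -> forall x, closure A x -> 0 <= l x.
Proof.
move=> lc l0 x cx; have : closed (l @^-1` [set y | 0 <= y]).
  by apply: closed_comp => [? _|]; [exact: lc|exact: closed_ge].
by move=> /closure_id; rewrite predeqE => /(_ x)[_]; apply; apply: closureS cx.
Qed.

End OpenConvex.

(** * Smooth maps *)

Lemma near_eq_diff (R : realType) (E F : normedModType R) (f g : E -> F) x :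
  {near x, f =1 g} -> differentiable f x ->
  differentiable g x /\ 'd g x = 'd f x :> (E -> F).
Proof.
move=> fg df; have dg : g \o shift x = cst (g x) + 'd f x +o_ 0 id.
  apply/eqaddoP => e e0; have /eqaddoP/(_ _ e0) := diff_locally df.
  have gf : \forall h \near 0, f (h + x) = g (h + x).
    have /nbhs_ballP[d d0 H] := fg; apply/nbhs_ballP; exists d => // h.
    rewrite -ball_normE /= sub0r normrN => hd; apply: H.
    by rewrite -ball_normE /= opprD addrCA subrr addr0 normrN.
  apply: filterS2 gf => h /= gfh; rewrite !fctE /= gfh.
  by rewrite (nbhs_singleton fg).
have dgE := diff_unique (diff_continuous df) dg; split=> //.
by apply/diff_locallyP; rewrite dgE; split => //; exact: diff_continuous.
Qed.

Section Smooth.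
Context {R : realType} {E F : normedModType R}.
Implicit Types (U : set E) (k : nat).

Lemma smooth_on_sub U U' (f : E -> F) : U' `<=` U -> smooth_on U f ->
  smooth_on U' f.
Proof.
move=> UU' sf k; have := sf k; elim: k f {sf} => [|k IH] f /=.
  by move=> H x /UU'; exact: H.
by move=> [H1 H2]; split=> [x /UU'|v]; [exact: H1|exact/IH/H2].
Qed.

Lemma smooth_on_derive U (f : E -> F) v : smooth_on U f ->
  smooth_on U (fun x => 'D_v f x).
Proof. by move=> sf k; case: (sf k.+1) => _; exact. Qed.

Lemma Ck_on_ext k U (f g : E -> F) : open U -> (forall x, U x -> f x = g x) ->
  Ck_on k U f -> Ck_on k U g.
Proof.
move=> oU; elim: k f g => [|k IH] f g fg /= cf.
  move=> x Ux; have fgx : {near x, f =1 g}.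
    by near=> y; apply: fg; near: y; exact: open_nbhs_nbhs.
  apply: cvg_trans (near_eq_cvg fgx) _.
  by rewrite -(fg _ Ux); exact: cf.
have fgx x : U x -> {near x, f =1 g}.
  by move=> Ux; near=> y; apply: fg; near: y; exact: open_nbhs_nbhs.
split=> [x Ux|v]; first exact: (near_eq_diff (fgx _ Ux) (cf.1 x Ux)).1.
by apply: IH (cf.2 v) => x Ux; apply: near_eq_derive; exact: fgx.
Unshelve. all: by end_near. Qed.

(** The induction is over all pairs [f], [g] at once, because a directional derivative of such a
    combination is again one, with differentiated coefficients. *)
Lemma smooth_on_comb U (f g : E -> R) (w z : F) : open U ->
  smooth_on U f -> smooth_on U g ->
  smooth_on U (fun y => f y *: w - g y *: z).
Proof.
move=> oU sf sg k; have := sf k; have := sg k; move: f g {sf sg}.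
elim: k => [|k IH] f g /= cf cg.
  move=> x Ux; apply: continuousB.
    by apply: continuousZl; exact: cg.
  by apply: continuousZl; exact: cf.
split=> [x Ux|v].
  apply: differentiableB; apply: differentiableZl; first exact: cg.1.
  exact: cf.1.
apply: Ck_on_ext (IH _ _ (cf.2 v) (cg.2 v)) => // x Ux.
have df := cf.1 _ Ux; have dg := cg.1 _ Ux.
have dfz := differentiableZl z df; have dgw := differentiableZl w dg.
have derZ (h : E -> R) (a : F) : differentiable h x ->
    'D_v (fun y => h y *: a) x = 'D_v h x *: a.
  by move=> dh; rewrite !deriveE ?diffZl//; exact: differentiableZl.
by rewrite deriveB ?derZ//; exact: diff_derivable.
Qed.

End Smooth.

Lemma continuous_slice (R : realType) (E F : normedModType R) (x0 : E) :
  continuous (fun v : F => (x0, v)).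
Proof. by move=> v; apply: cvg_pair => //=; exact: cvg_cst. Qed.

Lemma derive_slice (R : realType) (E F : normedModType R) (f : E * F -> R)
    x0 (v y : F) :
  'D_v (fun y => f (x0, y)) y = 'D_(0, v) f (x0, y).
Proof.
rewrite /derive; congr (lim _).
apply: (congr1 (fun g : R -> R => g @ 0^')); apply/funext => h /=.
congr (_ *: (f _ - _)).
have -> : h *: (0, v) + (x0, y) = (h *: 0 + x0, h *: v + y) :> E * F by [].
by rewrite scaler0 add0r.
Qed.

(** The derivative of a slice along [v] is the slice of the derivative along [(0, v)], so the class
    of slices is stable under the recursion in [Ck_on]. *)
Lemma smooth_on_slice (R : realType) (E F : normedModType R)
    (U : set (E * F)) (f : E * F -> R) x0 : smooth_on U f ->
  smooth_on [set v | U (x0, v)] (fun v => f (x0, v)).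
Proof.
move=> sf k; have := sf k; elim: k f {sf} => [|k IH] f /= cf.
  move=> v Uv; apply: (@continuous_comp _ _ _ (fun v : F => (x0, v)) f).
    exact: continuous_slice.
  exact: cf.
split=> [v Uv|v].
  apply: (@differentiable_comp _ _ _ _ (fun v : F => (x0, v)) f).
    exact: differentiable_pair.
  exact: cf.1.
rewrite (_ : (fun _ => _) = fun y => 'D_(0, v) f (x0, y)).
  exact: (IH (fun z => 'D_(0, v) f z) (cf.2 (0, v))).
by apply/funext => y; rewrite derive_slice.
Qed.

(** * Strong cones *)

Section StrongCone.
Context {R : realType} {E : normedModType R} (C A : set E).
Hypotheses (sC : strong_cone C A) (hC : hypersurface C).
Implicit Types (a v w x y : E) (l : {linear E -> R}).

Let oA := strong_cone_open sC.
Let cA := strong_cone_convex sC.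

Lemma strong_coneE v : C v <-> [/\ closure A v, ~ A v & v <> 0].
Proof.
rewrite (strong_cone_boundary sC) ((interior_id _).1 oA).
by split=> [[[? ?] ?]|[? ? ?]].
Qed.

(** Only [C] is assumed conic. If the segment from [a] to [t *: a] left [A], it would do so at a
    positive multiple of [a] lying in [C], and then [a] itself would lie in [C]. *)
Lemma inner_cone a (t : R) : A a -> 0 < t -> A (t *: a).
Proof.
move=> Aa t0; apply: contrapT => nA.
have [s /andP[s0 s1] [cz nz]] := boundary_segment oA Aa nA.
have zE : a + s *: (t *: a - a) = (1 - s + s * t) *: a by lmodule; ring.
rewrite zE in cz nz; have r0 : 0 < 1 - s + s * t by nra.
have a0 : a <> 0 by move=> a0; apply: (strong_cone_neq0 sC); rewrite -a0.
have Cz : C ((1 - s + s * t) *: a).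
  apply/strong_coneE; split=> //; apply/eqP; rewrite scaler_eq0 gt_eqF//=.
  exact/eqP.
have : C a.
  have := strong_cone_conic sC Cz; move=> /(_ (1 - s + s * t)^-1).
  by rewrite invr_gt0 scalerA mulVf ?gt_eqF// scale1r; apply.
by move=> /strong_coneE[].
Qed.

Lemma closure_innerE x : closure A x -> [\/ A x, C x | x = 0].
Proof.
move=> cx; have [Ax|nAx] := pselect (A x); first exact: Or31.
have [->|x0] := pselect (x = 0); first exact: Or33.
by apply: Or32; apply/strong_coneE.
Qed.

Lemma cone_closure v : C v -> closure A v.
Proof. by move=> /strong_coneE[]. Qed.

Lemma cone_neq0 v : C v -> v != 0.
Proof. by move=> /strong_coneE[_ _ /eqP]. Qed.

Lemma cone_not_inner v : C v -> ~ A v.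
Proof. by move=> /strong_coneE[]. Qed.

Lemma cone_inner_neq0 v : C v -> A !=set0.
Proof.
by move=> /cone_closure /(closure_ballP _ _).1 /(_ 1 ltr01)[y Ay _]; exists y.
Qed.

Lemma closure_innerZ x (t : R) : closure A x -> 0 < t -> closure A (t *: x).
Proof.
move=> cx t0; have [Ax|Cx|x0] := closure_innerE cx.
- by apply: subset_closure; exact: inner_cone.
- by apply: cone_closure; exact: (strong_cone_conic sC Cx t0).
- by rewrite x0 scaler0 -x0.
Qed.

Lemma closure_innerD x y : closure A x -> closure A y -> closure A (x + y).
Proof.
move=> cx cy; have A0 : A !=set0.
  by case: ((closure_ballP _ _).1 cx _ ltr01) => z Az _; exists z.
rewrite (_ : x + y = 2 *: (x + 2^-1 *: (y - x))); last by lmodule; field.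
apply: closure_innerZ => //; apply: closure_convex => //.
by rewrite invr_ge0 ler0n invf_le1// ler1n.
Qed.

Lemma inner_closureD a x : A a -> closure A x -> A (a + x).
Proof.
move=> Aa cx.
rewrite (_ : a + x = 2 *: (x + 2^-1 *: (a - x))); last by lmodule; field.
apply: inner_cone => //; apply: convex_segment_interior => //.
by rewrite invr_gt0 ltr0n invf_le1// ler1n.
Qed.

(** Salience is postulated on [C] only; if one of [x], [- x] lay in [A], their sum 0 would lie in
    [A]. *)
Lemma closure_inner_pointed x : closure A x -> closure A (- x) -> x = 0.
Proof.
move=> cx cNx.
have nA : forall y, A y -> ~ closure A (- y).
  move=> y Ay /(inner_closureD Ay); rewrite subrr.
  exact: strong_cone_neq0 sC.
have [Ax|Cx|//] := closure_innerE cx; first by case: (nA _ Ax).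
have [ANx|CNx|/eqP] := closure_innerE cNx; last by rewrite oppr_eq0 => /eqP.
  by case: (nA _ ANx); rewrite opprK.
by case: (strong_cone_salient sC Cx).
Qed.

Lemma cone_tangent_radial v : C v -> tangent_cone C v v.
Proof.
move=> Cv e e0; exists 1 => // t /andP[t0 _]; exists (v + t *: v).
  rewrite (_ : v + _ = (1 + t) *: v); last by lmodule; ring.
  by apply: (strong_cone_conic sC Cv); rewrite addr_gt0.
by rewrite subrr normr0 mulr_ge0// ltW.
Qed.

(** A ball of radius [r] around [a] in [A] contracts towards [v] to balls of radius [t * r] in [A],
    whereas tangency would place points of [C] within [t * r / 2] of their centres. *)
Lemma inner_not_tangent v a : C v -> A a -> ~ tangent_cone C v (a - v).
Proof.
move=> Cv Aa tv; have [r r0 rA] := open_nbhs_ball oA Aa.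
have [d d0] := tv _ (divr_gt0 r0 (@ltr0n R 2)).
pose t := Num.min d 1 / 2; have t0 : 0 < t by rewrite divr_gt0// lt_min d0/=.
have td : t < d.
  rewrite ltr_pdivrMr// (@le_lt_trans _ _ d)// ?ge_min ?lexx//.
  by rewrite ltr_pMr// ltr1n.
have t1 : t <= 1.
  rewrite ler_pdivrMr// (@le_trans _ _ 1)// ?ge_min ?lexx ?orbT//.
  by rewrite mul1r ler1n.
move=> /(_ t); rewrite t0 td => /(_ isT)[y Cy yt].
pose k := y - (v + t *: (a - v)).
apply: (cone_not_inner Cy).
rewrite (_ : y = v + t *: (a + t^-1 *: k - v)).
  apply: convex_segment_interior => //; [|exact: cone_closure|by rewrite t0].
  apply: rA; rewrite normrZ gtr0_norm ?invr_gt0// ltr_pdivrMl// mulrC.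
  by rewrite (le_lt_trans yt)// ltr_pM2r// ltr_pdivrMr// ltr_pMr// ltr1n.
by rewrite /k; lmodule; field; rewrite gt_eqF.
Qed.

(** The form is the differential of a local equation. A zero on [A] would make some [a - v] tangent,
    so it has constant sign on the convex set [A] and can be oriented inwards. *)
Lemma cone_normal v : C v -> exists l, [/\ continuous l,
  tangent_space C v = [set x | l x = 0], l v = 0 & forall a, A a -> 0 < l a].
Proof.
move=> Cv; have [f eqf] := hC Cv.
have tE := tangent_spaceE eqf Cv.
have lv : 'd f v v = 0.
  exact: tangent_cone_sub_ker eqf Cv (cone_tangent_radial Cv).
have lc := diff_continuous (local_equation_diff eqf).
have : forall a, A a -> 'd f v a != 0.
  move=> a Aa; apply/eqP => la; apply: (inner_not_tangent Cv Aa).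
  by apply: (ker_sub_tangent_cone eqf Cv); rewrite !lformE la lv subrr.
move=> /(convex_nonvanishing cA)[lA|lA]; first by exists ('d f v).
exists (\- 'd f v : {linear E -> R}); split => [x||/=|a Aa /=].
- by apply: continuousN; exact: lc.
- rewrite tE; apply/seteqP; split=> x /= => [->|/eqP]; rewrite ?oppr0//.
  by rewrite oppr_eq0 => /eqP.
- by rewrite lv oppr0.
- by rewrite oppr_gt0 lA.
Qed.

(** If [l w < 0] for a tangent [w], points of [C] near [v + t *: w] would have negative [l],
    although they lie in the closure of [A]. The same argument for [- w] gives equality. *)
Lemma support_tangent v l : C v -> continuous l ->
  (forall a, A a -> 0 <= l a) -> l v = 0 ->
  tangent_space C v `<=` [set w | l w = 0].
Proof.
move=> Cv lc lA lv.
suff H : forall w, tangent_space C v w -> 0 <= l w.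
  move=> w tw; apply/eqP; rewrite eq_le H// andbT -oppr_ge0.
  rewrite -(lformN l); apply: H; have [k [_ kE _ _]] := cone_normal Cv.
  by move: tw; rewrite kE /= !lformE => ->; rewrite oppr0.
move=> w /(tangent_space_cone _ hC Cv) tw; rewrite leNgt; apply/negP => lw.
have [K K0 lK] := linear_bound lc.
have e0 : 0 < - l w / (2 * K) by rewrite divr_gt0 ?oppr_gt0// mulr_gt0.
have [d d0 /(_ (d / 2))] := tw _ e0.
have d20 : 0 < d / 2 by rewrite divr_gt0.
case; first by rewrite d20/= ltr_pdivrMr// ltr_pMr// ltr1n.
move=> y Cy yd.
have := closure_ge0 lc lA (cone_closure Cy); apply/negP; rewrite -ltNge.
rewrite -(subrK (v + (d / 2) *: w) y) !lformE lv add0r.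
have := le_trans (lK _) (ler_wpM2l (ltW K0) yd).
rewrite !lformE lv ler_norml => /andP[_ ].
have -> : K * (- l w / (2 * K) * (d / 2)) = - (l w * (d / 2)) / 2.
  by field; rewrite gt_eqF.
have : l w * (d / 2) < 0 by rewrite pmulr_llt0.
lra.
Qed.

Lemma support_tangentE v l : C v -> continuous l ->
  (forall a, A a -> 0 <= l a) -> (exists x, l x != 0) -> l v = 0 ->
  tangent_space C v = [set w | l w = 0].
Proof.
move=> Cv lc lA [x lx] lv; have sub := support_tangent Cv lc lA lv.
apply/seteqP; split=> // w /= lw; have [k [_ kE _ _]] := cone_normal Cv.
rewrite kE in sub *.
have kx : k x != 0 by apply: contra_neqN lx => /eqP; exact: sub.
have := sub (w - (k w / k x) *: x); rewrite /= !(lformE k) !(lformE l) lw.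
rewrite divfK// subrr => /(_ erefl)/eqP.
rewrite sub0r oppr_eq0 !mulf_eq0 (negbTE lx) invr_eq0 (negbTE kx) !orbF.
by move=> /eqP.
Qed.

End StrongCone.

(** * Strict convexity of strong cones *)

Lemma diff_ge0 (R : realType) (E : normedModType R) (g : E -> R) x v (d : R) :
  differentiable g x -> g x = 0 -> 0 < d ->
  (forall t, 0 < t < d -> 0 <= g (x + t *: v)) -> 0 <= 'd g x v.
Proof.
move=> dg gx0 d0 gd; rewrite leNgt; apply/negP => gv.
have v1 : 0 < `|v| + 1 by rewrite ltr_wpDl.
have e0 : 0 < - 'd g x v / (2 * (`|v| + 1)).
  by rewrite divr_gt0 ?oppr_gt0// mulr_gt0.
have [r r0 exp] := diff_expansion dg e0.
pose t := Num.min d (r / (`|v| + 1)) / 2.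
have t0 : 0 < t by rewrite divr_gt0// lt_min d0 divr_gt0.
have tlt : t < Num.min d (r / (`|v| + 1)).
  by rewrite /t ltr_pdivrMr// ltr_pMr ?ltr1n// lt_min d0 divr_gt0.
have td : t < d by rewrite (lt_le_trans tlt)// ge_min lexx.
have tr : t * (`|v| + 1) < r.
  by rewrite -ltr_pdivlMr// (lt_le_trans tlt)// ge_min lexx orbT.
have := exp (t *: v); rewrite normrZ gtr0_norm//.
have tv : t * `|v| < t * (`|v| + 1) by rewrite ltr_pM2l// ltrDl.
rewrite (lt_trans tv)// gx0 subr0 => /(_ isT).
have -> : 'd g x (t *: v) = t * 'd g x v by exact: linearZ.
rewrite ler_norml => /andP[_]; apply/negP; rewrite -ltNge.
have gt : 0 <= g (x + t *: v) by apply: gd; rewrite t0.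
have : - 'd g x v / (2 * (`|v| + 1)) * (t * `|v|) < - (t * 'd g x v) / 2.
  rewrite (_ : _ / 2 = - 'd g x v / (2 * (`|v| + 1)) * (t * (`|v| + 1))).
    by rewrite ltr_pM2l.
  by field; rewrite gt_eqF.
have : t * 'd g x v < 0 by rewrite pmulr_rlt0.
lra.
Qed.

Section StrictConvexity.
Context {R : realType} {E : normedModType R} (C A : set E).
Hypotheses (sC : strong_cone C A) (hC : hypersurface C).

(** The segment lies in the face cut out by [l], which avoids [A]; salience keeps it away from the
    origin. *)
Lemma cone_segment v w (t : R) (l : {linear E -> R}) : C v -> C w ->
  (forall a, A a -> 0 < l a) -> l v = 0 -> l w = 0 -> 0 <= t < 1 ->
  C (v + t *: (w - v)).
Proof.
move=> Cv Cw lA lv lw /andP[t0 t1]; apply/(strong_coneE sC); split.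
- have t01 : 0 <= t <= 1 by rewrite t0 ltW.
  exact: (closure_convex (strong_cone_open sC) (strong_cone_convex sC)
    (cone_inner_neq0 sC Cv) (cone_closure sC Cv) (cone_closure sC Cw) t01).
- by move=> /lA; rewrite !(lformE l) lv lw subrr mulr0 addr0 ltxx.
- move=> z0; have [t00|tn0] := eqVneq t 0.
    move: z0 (cone_neq0 sC Cv); rewrite t00 scale0r addr0 => ->.
    by rewrite eqxx.
  have {tn0}t0 : 0 < t by rewrite lt_neqAle eq_sym tn0.
  apply: (strong_cone_salient sC Cv).
  rewrite (_ : - v = (t / (1 - t)) *: w).
    by apply: (strong_cone_conic sC Cw); rewrite divr_gt0// subr_gt0.
  have -> : - v = - v + (1 - t)^-1 *: (v + t *: (w - v)).
    by rewrite z0 scaler0 addr0.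
  by lmodule; field; rewrite gt_eqF// subr_gt0.
Qed.

(* Along the segment from [v] to [w] the tangent hyperplane is constant, so the
   tangential field [y |-> df_y(xi) Y - df_y(Y) xi] stays in it; differentiating
   in the direction [w - v] puts [w - v] in the radical. *)
Lemma cone_strictly_convex v w : C v -> C w -> tangent_space C v w ->
  exists2 a : R, 0 < a & w = a *: v.
Proof.
move=> Cv Cw tw.
have [xi [h [nxi _ sff _ rad]]] := strong_cone_strongly_convex sC Cv.
have [l [lc lE lv lA]] := cone_normal sC hC Cv.
have lw : l w = 0 by move: tw; rewrite lE.
have lA0 a : A a -> 0 <= l a by move=> /lA /ltW.
have lneq0 : exists x, l x != 0.
  by have [a Aa] := cone_inner_neq0 sC Cv; exists a; rewrite gt_eqF// lA.
have lxi : l xi != 0 by apply/eqP => lxi; apply: nxi; rewrite lE.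
pose X := w - v; have lX : l X = 0 by rewrite !(lformE l) lv lw subrr.
have zC t : 0 <= t < 1 -> C (v + t *: X).
  exact: (cone_segment Cv Cw) lA lv lw.
have zT t : 0 <= t < 1 -> tangent_space C (v + t *: X) = [set x | l x = 0].
  move=> /zC Cz; apply: (support_tangentE sC hC) Cz _ _ _ _ => //.
  by rewrite !(lformE l) lv lw subrr mulr0 addr0.
have [f eqf] := hC Cv; have [U [[oU Uv] sf CU _]] := eqf.
have df y : U y -> differentiable f y by case: (sf 1) => + _; exact.
(* On this neighborhood [xi] witnesses regularity, so [f] is a local equation at every nearby point
   of [C] and not only at [v]. *)
pose W := U `&` [set y | 'D_xi f y != 0].
have Dxi : 'D_xi f v != 0.
  rewrite deriveE; last exact: df.
  by apply/eqP => dxi; apply: nxi; exists f.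
have oW : open W.
  rewrite openE => y [Uy Dy]; apply: filterI; first exact: open_nbhs_nbhs.
  have cD : {for y, continuous (fun x => 'D_xi f x)}.
    by have := smooth_on_derive xi sf; move=> /(_ 0); exact.
  apply: (cD [set r | r != 0]).
  by apply: open_nbhs_nbhs; split => //; exact: open_neq.
have eqW y : W y -> local_equation C y f.
  move=> [Uy Dy]; exists U; split => //; exists xi.
  by rewrite -deriveE//; exact: df.
have WC y : W y -> C y -> tangent_space C y = [set x | 'd f y x = 0].
  by move=> Wy Cy; exact: tangent_spaceE (eqW _ Wy) Cy.
have [a Xa] : exists a : R, X = a *: v.
  apply/rad => [|Y]; rewrite lE// => lY.
  (* This scaling makes the field below take the value [Y] at [v]. *)
  pose Y' := ('D_xi f v)^-1 *: Y.
  pose V y := 'D_xi f y *: Y' - 'D_Y' f y *: xi.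
  have lY' : l Y' = 0 by rewrite !(lformE l) lY mulr0.
  have sV : smooth_on W V.
    apply: smooth_on_comb => //; apply: smooth_on_derive;
      by apply: smooth_on_sub sf => ? [].
  have tV y : W y -> C y -> tangent_space C y (V y).
    move=> Wy Cy; have dfy := df _ Wy.1; rewrite (WC _ Wy Cy) /= /V.
    rewrite lformD lformN (lformZ _ _ Y') (lformZ _ _ xi).
    by rewrite !(deriveE _ dfy) mulrC subrr.
  have zV t : 0 <= t < 1 -> W (v + t *: X) -> l (V (v + t *: X)) = 0.
    move=> t01 Wz; have Y'z : 'D_Y' f (v + t *: X) = 0.
      rewrite deriveE; last exact: df Wz.1.
      have : [set x | l x = 0] Y' by [].
      by rewrite -(zT _ t01) (WC _ Wz (zC _ t01)).
    by rewrite /V Y'z scale0r subr0 (lformZ _ _ Y') lY' mulr0.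
  have Wv : W v by [].
  have z0 : v + 0 *: X = v by rewrite scale0r addr0.
  have t00 : 0 <= (0 : R) < 1 by rewrite lexx ltr01.
  have VY : V v = Y.
    rewrite /V (_ : 'D_Y' f v = 0).
      by rewrite scale0r subr0 scalerA divff ?scale1r.
    rewrite deriveE; last exact: df.
    have : [set x | l x = 0] Y' by [].
    by rewrite -(zT _ t00) z0 (WC _ Wv Cv).
  have dV : differentiable V v by case: (sV 1) => + _; exact.
  have [d d0 dW] := open_nbhs_ball oW Wv.
  (* The segment is available for [t >= 0] only, so one gets an inequality on the derivative; using
     it for [l] and [\- l] yields [l ('D_X V v) = 0]. *)
  have dd (m : {linear E -> R}) : continuous m ->
      (forall t, 0 <= t < 1 -> W (v + t *: X) -> m (V (v + t *: X)) = 0) ->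
      0 <= m ('D_X V v).
    move=> mc mV; rewrite deriveE//.
    have dm : differentiable m (V v) by exact: linear_differentiable.
    have -> : m ('d V v X) = 'd (m \o V) v X by rewrite diff_comp//= diff_lin.
    have X1 : 0 < `|X| + 1 by rewrite ltr_wpDl.
    apply: (@diff_ge0 _ _ _ _ _ (Num.min 1 (d / (`|X| + 1)))).
    - exact: differentiable_comp.
    - by have := mV 0 t00; rewrite z0 => /(_ Wv).
    - by rewrite lt_min ltr01 divr_gt0.
    - move=> t /andP[t0]; rewrite lt_min => /andP[t1 td]; rewrite /= mV//.
        by rewrite ltW.
      apply: dW; rewrite normrZ gtr0_norm//; move: td; rewrite ltr_pdivlMr//.
      by apply: le_lt_trans; rewrite ler_pM2l// lerDl.
  have lDV : l ('D_X V v) = 0.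
    apply/eqP; rewrite eq_le dd// andbT -oppr_ge0.
    apply: (dd (\- l : {linear E -> R})) => [x|t t01 Wz /=].
      by apply: continuousN; exact: lc.
    by rewrite zV// oppr0.
  (* Applying [l] to the Gauss formula leaves [h X Y * l xi = 0], with [l xi] nonzero. *)
  have := sff W X V (conj oW Wv) sV tV.
  rewrite lE VY => /(_ lX) /=.
  rewrite !(lformE l) lDV sub0r => /eqP.
  by rewrite oppr_eq0 mulf_eq0 (negbTE lxi) orbF => /eqP.
have wE : w = (1 + a) *: v.
  by rewrite scalerDl scale1r -Xa /X addrC subrK.
have [a0|a0|a0] := ltgtP (1 + a) 0; last 1 first.
- by move: (cone_neq0 sC Cw); rewrite wE a0 scale0r eqxx.
- case: (strong_cone_salient sC Cv).
  rewrite (_ : - v = (- (1 + a)^-1) *: w).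
    by apply: (strong_cone_conic sC Cw); rewrite oppr_gt0 invr_lt0.
  by rewrite wE; lmodule; field; rewrite lt_eqF.
- by exists (1 + a).
Qed.

End StrictConvexity.

(** * Fibers and boundaries in a manifold *)

Lemma diff_gt0 (R : realType) (E : normedModType R) (g : E -> R) x v :
  differentiable g x -> g x = 0 -> 0 < 'd g x v ->
  exists2 d : R, 0 < d & forall t, 0 < t < d -> 0 < g (x + t *: v).
Proof.
move=> dg gx0 gv.
have v1 : 0 < `|v| + 1 by rewrite ltr_wpDl.
have [r r0 exp] := diff_expansion dg (divr_gt0 gv v1).
exists (r / (`|v| + 1)) => [|t /andP[t0]]; first by rewrite divr_gt0.
rewrite ltr_pdivlMr// => tr.
have tv : t * `|v| < t * (`|v| + 1) by rewrite ltr_pM2l// ltrDl.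
have := exp (t *: v); rewrite normrZ gtr0_norm// (lt_trans tv)// gx0 subr0.
move=> /(_ isT); rewrite (lformZ _ t v) ler_norml => /andP[+ _].
have : 'd g x v / (`|v| + 1) * (t * `|v|) < t * 'd g x v.
  rewrite [ltRHS](_ : _ = 'd g x v / (`|v| + 1) * (t * (`|v| + 1))).
    by rewrite ltr_pM2l// divr_gt0.
  by field; rewrite gt_eqF.
lra.
Qed.

Section Charts.
Context {R : realType} {m : nat} {Q : smoothManifold R m}.
Implicit Types (p q : Q) (c : chart Q) (U eta D O : set Q).

Lemma chart_inj c p q : cdom c p -> cdom c q -> cmap c p = cmap c q -> p = q.
Proof. by move=> cp cq pq; rewrite -(cmapK cp) pq cmapK. Qed.

Lemma chart_image_open c U : open U -> open (cmap c @` (U `&` cdom c)).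
Proof.
move=> oU; rewrite openE => _ [q [Uq cq] <-].
have cy : (cmap c @` cdom c) (cmap c q) by exists q.
have : nbhs (cmap c q) (cinv c @^-1` U).
  by apply: (cinv_continuous cy); rewrite cmapK//; exact: open_nbhs_nbhs.
have : nbhs (cmap c q) (cmap c @` cdom c).
  by apply: open_nbhs_nbhs; split => //; exact: cimage_open.
apply: filterS2 => _ [q' cq' <-]; rewrite /= cmapK// => Uq'.
by exists q'.
Qed.

Lemma coord_chart_at p v : Defs.coord (chart_at p) p v = v.
Proof.
rewrite /Defs.coord; set c := chart_at p.
have near_id : {near cmap c p, id =1 cmap c \o cinv c}.
  have : nbhs (cmap c p) (cmap c @` cdom c).
    apply: open_nbhs_nbhs; split; first exact: cimage_open.
    by exists p => //; exact: chart_at_dom.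
  by apply: filterS => _ [q cq <-] /=; rewrite cmapK.
have did : differentiable (@id 'rV[R]_m) (cmap c p) by [].
have [_ ->] := near_eq_diff near_id did.
by rewrite (@diff_lin _ _ _ idfun)// => ?; exact.
Qed.

(** A bundle equation is restricted to the fiber over [x0]. Transversality lets a vector with
    nonzero derivative be made vertical modulo the tangent space, so the restriction stays
    regular. *)
Lemma fiber_hypersurface U (C A : Q -> set 'rV[R]_m) p :
  cone_structure_on U C A -> U p -> hypersurface (C p).
Proof.
move=> CU Up v Cv; pose c := chart_at p; pose x0 := cmap c p.
have cp : cdom c p by exact: chart_at_dom.
pose S := bundle_chart_set U C c.
have SE w : S (x0, w) <-> C p w.
  split=> [[q [w' [Uq cq Cw' [x0q ->]]]]|Cw].
    by move: Cw'; rewrite -(chart_inj cp cq x0q) coord_chart_at.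
  by exists p, w; split => //; rewrite coord_chart_at.
have Sz : S (x0, v) by apply/SE.
have [f eqf] := cone_on_hypersurface CU Sz.
have [W [[oW Wz] sf SW [t ft]]] := eqf.
have dg w : 'd (fun y => f (x0, y)) v w = 'd f (x0, v) (0, w).
  have dfz : differentiable f (x0, v) by exact: local_equation_diff eqf.
  have dfv : differentiable (fun y => f (x0, y)) v.
    by have [+ _] := smooth_on_slice x0 sf 1; exact.
  by rewrite -(deriveE _ dfz) -(deriveE _ dfv) derive_slice.
exists (fun y => f (x0, y)), [set y | W (x0, y)]; split.
- split=> //; apply: (@open_comp _ _ (fun y => (x0, y)) W) => // y _.
  exact: continuous_slice.
- exact: smooth_on_slice.
- by move=> y Wy; rewrite -SE; exact: SW.
- have [w [s [ts tE]]] := cone_on_transverse CU Sz t.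
  exists w; rewrite dg; move: ts; rewrite (tangent_spaceE eqf Sz) /= => fs.
  by move: ft; rewrite tE linearD fs addr0.
Qed.

Lemma mlocal_equation_chart eta p f : mlocal_equation eta p f ->
  local_equation (cmap (chart_at p) @` (eta `&` cdom (chart_at p)))
    (cmap (chart_at p) p) (f \o cinv (chart_at p)).
Proof.
move=> [U [[oU Up] sf etaU reg]]; set c := chart_at p.
have cp : cdom c p by exact: chart_at_dom.
exists (cmap c @` (U `&` cdom c)); split => //.
- by split; [exact: chart_image_open|exists p].
- move=> _ [q [Uq cq] <-] /=; rewrite cmapK//.
  split=> [[q' [eq' cq'] /(chart_inj cq' cq) q'q]|/(etaU _ Uq)].
    by apply/etaU => //; rewrite -q'q.
  by exists q.
Qed.

Lemma mtangent_spaceE eta p f : eta p -> mlocal_equation eta p f ->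
  mtangent_space eta p = [set v | differential f p v = 0].
Proof.
move=> etap eqf; pose c := chart_at p.
have Sx : (cmap c @` (eta `&` cdom c)) (cmap c p).
  by exists p => //; split=> //; exact: chart_at_dom.
apply/seteqP; split=> v => [[g eqg gv]|fv]; last by exists f.
apply: (tangent_cone_sub_ker (mlocal_equation_chart eqf) Sx).
exact: ker_sub_tangent_cone (mlocal_equation_chart eqg) Sx gv.
Qed.

(** Moving along [v] enters [f > 0], hence [D], hence [g >= 0], so the derivative of [g] is
    nonnegative; it is nonzero because [f] and [g] have the same tangent kernel. *)
Lemma boundary_equation_gt0 D eta p f g v : eta p ->
  boundary_equation D eta p f -> boundary_equation D eta p g ->
  0 < differential f p v -> 0 < differential g p v.
Proof.
move=> etap [eqf Df] [eqg Dg] fv; pose c := chart_at p; pose x := cmap c p.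
have cp : cdom c p by exact: chart_at_dom.
have root h : mlocal_equation eta p h -> (h \o cinv c) x = 0.
  by move=> [U [[_ Up] _ /(_ _ Up) + _]] /=; rewrite /x cmapK// => -[->].
rewrite lt_neqAle eq_sym; apply/andP; split.
  apply/eqP => gv; have : mtangent_space eta p v.
    by rewrite (mtangent_spaceE etap eqg).
  by rewrite (mtangent_spaceE etap eqf) /=; apply/eqP; rewrite gt_eqF.
have diff h : mlocal_equation eta p h -> differentiable (h \o cinv c) x.
  by move=> /mlocal_equation_chart/local_equation_diff.
have [d1 d10 fgt] := diff_gt0 (diff _ eqf) (root _ eqf) fv.
have fg : \forall q \near p, 0 <= f q -> 0 <= g q.
  by apply: filterS2 Df Dg => q -> ->.
have : nbhs x (cinv c @^-1` [set q | 0 <= f q -> 0 <= g q]).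
  by apply: (@cinv_continuous _ _ _ c); [exists p|rewrite cmapK].
move=> /nbhs_ballP[d2 /= d20 d2P].
have v1 : 0 < `|v| + 1 by rewrite ltr_wpDl.
apply: (@diff_ge0 _ _ _ _ _ (Num.min d1 (d2 / (`|v| + 1)))).
- exact: diff.
- exact: root.
- by rewrite lt_min d10 divr_gt0.
- move=> t /andP[t0]; rewrite lt_min ltr_pdivlMr// => /andP[t1 t2].
  apply: d2P; last by rewrite ltW// fgt// t0.
  rewrite -ball_normE /= opprD addrA subrr sub0r normrN normrZ gtr0_norm//.
  by rewrite (le_lt_trans _ t2)// ler_pM2l// lerDl.
Qed.

Lemma boundary_form eta O p : eta p -> domain_with_boundary (closure O) eta ->
  closure O p /\ exists l : {linear 'rV[R]_m -> R},
  [/\ continuous l, exists x, l x != 0, mtangent_space eta p = [set v | l v = 0]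
    & side_halfspace eta O p = [set v | 0 < l v]].
Proof.
move=> etap /(_ _ etap)[f bf]; have [eqf Of] := bf.
split.
  apply/(nbhs_singleton Of).
  by have [U [[_ Up] _ /(_ _ Up) + _]] := eqf => -[-> //].
exists ('d (f \o cinv (chart_at p)) (cmap (chart_at p) p)); split.
- apply: diff_continuous.
  exact: local_equation_diff (mlocal_equation_chart eqf).
- by have [? []] := eqf.
- exact: mtangent_spaceE.
- apply/seteqP; split=> v => [[g bg gv]|fv]; last by exists f.
  exact: boundary_equation_gt0 bg bf gv.
Qed.

End Charts.

(** * Supporting hyperplanes in a pencil *)

Lemma ker_sub_proportional (R : realType) (E : normedModType R)
    (k l : {linear E -> R}) : (exists x, k x != 0) ->
  [set x | l x = 0] `<=` [set x | k x = 0] ->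
  exists2 c : R, c != 0 & forall x, k x = c * l x.
Proof.
move=> [x kx] lk; have lx : l x != 0 by apply: contra_neqN kx => /eqP /lk.
exists (k x / l x) => [|y]; first by rewrite mulf_neq0 ?invr_eq0.
have := lk (y - (l y / l x) *: x); rewrite /= !(lformE l) !(lformE k) divfK//.
by rewrite subrr => /(_ erefl)/eqP; rewrite subr_eq0 => /eqP ->; ring.
Qed.

(** From a zero [a] in [A], a small move along [- l x *: x] would make [l] a negative multiple of
    the square of [l x]. *)
Lemma open_form_gt0 (R : realType) (E : normedModType R) (A : set E)
    (l : {linear E -> R}) : open A -> (forall a, A a -> 0 <= l a) ->
  (exists x, l x != 0) -> forall a, A a -> 0 < l a.
Proof.
move=> oA lA [x lx] a Aa; rewrite lt_neqAle eq_sym lA// andbT.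
apply/eqP => la; have [r r0 rA] := open_nbhs_ball oA Aa.
have x1 : 0 < `|l x *: x| + 1 by rewrite ltr_wpDl.
pose t := r / (`|l x *: x| + 1); have t0 : 0 < t by rewrite divr_gt0.
have : 0 <= l (a + (- t) *: (l x *: x)).
  apply/lA/rA; rewrite normrZ normrN gtr0_norm// /t mulrAC ltr_pdivrMr//.
  by rewrite ltr_pM2l// ltrDl.
rewrite !(lformE l) la add0r mulNr oppr_ge0 pmulr_rle0//.
by apply/negP; rewrite -ltNge -expr2 exprn_even_gt0.
Qed.

Section Refraction.
Context {R : realType} {m : nat}.
Notation V := 'rV[R]_m.
Context (C A : set V) (phi : {linear V -> R}).
Hypotheses (sC : strong_cone C A) (hC : hypersurface C) (phic : continuous phi).
Implicit Types (l : {linear V -> R}) (v w x : V) (s : R).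

Let oA := strong_cone_open sC.

(** The two witnesses are, up to scaling, the dual basis of [phi] and [l] modulo their common
    kernel. *)
Definition independent l :=
  (exists2 x, l x = 0 & phi x != 0) /\ (exists2 y, phi y = 0 & l y != 0).

(** An affine parameter for the pencil of hyperplanes, which omits only the kernel of [phi]. *)
Definition pencil l s : {linear V -> R} := l \- (s \*: phi).

Lemma pencilE l s x : pencil l s x = l x - s * phi x. Proof. by []. Qed.

Lemma pencil_continuous l s : continuous l -> continuous (pencil l s).
Proof.
move=> lc x; apply: continuousB; first exact: lc.
by apply: continuousM; [exact: cst_continuous|exact: phic].
Qed.

Lemma pencil_neq0 l s : independent l -> exists x, pencil l s x != 0.
Proof.
by move=> [_ [y py ly]]; exists y; rewrite pencilE py mulr0 subr0.
Qed.

Lemma independent_combination l (k : {linear V -> R}) : independent l ->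
  [set x | l x = 0] `&` [set x | phi x = 0] `<=` [set x | k x = 0] ->
  exists a b : R, forall x, k x = a * phi x + b * l x.
Proof.
move=> [[x lx px] [y py ly]] kP; exists (k x / phi x), (k y / l y) => z.
have := kP (z - (phi z / phi x) *: x - (l z / l y) *: y).
rewrite /= !(lformE l) !(lformE phi) !(lformE k) lx py !mulr0 subr0 oppr0 addr0.
rewrite !divfK// !subrr => /(_ (conj erefl erefl)) kz.
have -> : k z = phi z / phi x * k x + l z / l y * k y by lra.
ring.
Qed.

Definition supported l s v := [/\ C v, 0 < phi v, l v = s * phi v &
  forall x, closure A x -> 0 <= l x - s * phi x].

Lemma supported_tangent l s v : continuous l -> independent l ->
  supported l s v -> tangent_space C v = [set x | l x = s * phi x].
Proof.
move=> lc li [Cv pv lv lA].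
rewrite (support_tangentE sC hC Cv (@pencil_continuous l s lc)).
- apply/seteqP; split=> x /= => [/eqP|->]; last by rewrite subrr.
  by rewrite subr_eq0 => /eqP.
- by move=> a Aa; rewrite pencilE; apply: lA; exact: subset_closure.
- exact: pencil_neq0.
- by rewrite pencilE lv subrr.
Qed.

(** Evaluating each supporting form at the other vector forces [s = t]; then [w] lies in the tangent
    hyperplane at [v], and strict convexity applies. *)
Lemma supported_unique l s t v w : continuous l -> independent l ->
  supported l s v -> supported l t w -> same_direction v w.
Proof.
move=> lc li sv tw; have [Cv pv lv lAv] := sv; have [Cw pw lw lAw] := tw.
have := lAw _ (cone_closure sC Cv); rewrite lv -mulrBl pmulr_lge0// subr_ge0.
have := lAv _ (cone_closure sC Cw); rewrite lw -mulrBl pmulr_lge0// subr_ge0.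
move=> st ts; have {st ts}st : s = t by apply/eqP; rewrite eq_le st.
apply: (cone_strictly_convex sC hC) => //.
by rewrite (supported_tangent lc li sv) /= lw st.
Qed.

Lemma supported_exists l : continuous l -> independent l ->
  (forall x, closure A x -> x != 0 -> phi x = 0 -> 0 < l x) ->
  (exists2 c, closure A c & 0 < phi c) -> exists s v, supported l s v.
Proof.
move=> lc li lpos [c cc pc].
have normlc : continuous (fun x => `|l x|).
  by move=> x; apply: (@continuous_comp _ _ _ l Num.norm);
    [exact: lc|exact: norm_continuous].
pose K := closure A `&` [set x | `|x| = 1] `&` [set x | 0 <= phi x].
have Kn0 x : K x -> x != 0.
  by move=> [[_ /= x1] _]; rewrite -normr_eq0 x1 oner_neq0.
have KZ x : closure A x -> x != 0 -> 0 <= phi x -> K (`|x|^-1 *: x).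
  move=> cx x0 px; have nx : 0 < `|x|^-1 by rewrite invr_gt0 normr_gt0.
  split; [split|] => /=.
  - exact: (closure_innerZ sC cx nx).
  - by rewrite normrZ gtr0_norm// mulVf// normr_eq0.
  - by rewrite (lformZ phi) mulr_ge0// ltW.
have cK : compact K.
  apply: bounded_closed_compact.
    exists 1; split=> // M M1 x [[_ /= ->] _]; exact: ltW.
  apply: closedI; first (apply: closedI; first exact: closed_closure).
    by apply: (@closed_comp _ _ (fun x : V => `|x|) [set r | r = 1]) => [? _|];
      [exact: norm_continuous|exact: closed_eq].
  by apply: (@closed_comp _ _ phi [set r | 0 <= r]) => [? _|];
    [exact: phic|exact: closed_ge].
pose D x := phi x + `|l x|.
have D0 x : K x -> 0 < D x.
  move=> Kx; have [[cx _] /= px] := Kx.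
  rewrite lt_neqAle addr_ge0// andbT eq_sym.
  rewrite paddr_eq0// normr_eq0; apply/negP => /andP[/eqP px0 /eqP lx0].
  by have := lpos _ cx (Kn0 _ Kx) px0; rewrite lx0 ltxx.
have c0 : c != 0 by apply: contraTneq pc => ->; rewrite lform0 ltxx.
(* Minimizing [l / phi]; this quotient is an increasing function of it which
   stays bounded where [phi] vanishes. *)
have [v Kv vmin] : exists2 v, v \in K & forall x, x \in K ->
    l v / D v <= l x / D x.
  apply: compact_EVT_min => //.
    by exists (`|c|^-1 *: c); apply: KZ => //; exact: ltW.
  apply: continuous_in_subspaceT => x /set_mem Kx.
  apply: continuousM; first exact: lc.
  apply: continuousV; first by rewrite gt_eqF// D0.
  by apply: continuousD; [exact: phic|exact: normlc].
have {}Kv := set_mem Kv; have [[cv _] /= pv0] := Kv.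
have {}vmin x : K x -> l v * D x <= l x * D v.
  move=> Kx; have := vmin _ (mem_set Kx).
  by rewrite ler_pdivrMr ?D0// mulrAC ler_pdivlMr ?D0.
(* At a point with [phi = 0] the quotient equals 1, since [l] is positive there, while it is below 1
   at the normalized [c]. *)
have pv : 0 < phi v.
  rewrite lt_neqAle eq_sym pv0 andbT; apply/eqP => pv.
  have lv := lpos _ cv (Kn0 _ Kv) pv.
  have Kc := KZ _ cc c0 (ltW pc).
  have := vmin _ Kc; rewrite /D pv add0r (gtr0_norm lv) mulrC ler_pM2r//.
  apply/negP; rewrite -ltNge (le_lt_trans (ler_norm _))// ltrDr.
  by rewrite (lformZ phi) mulr_gt0// invr_gt0 normr_gt0.
pose s := l v / phi v.
have lv : l v = s * phi v by rewrite /s divfK// gt_eqF.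
have sK x : K x -> 0 <= l x - s * phi x.
  move=> Kx; have [_ /= px] := Kx.
  rewrite subr_ge0 /s mulrAC ler_pdivrMr//.
  have := vmin _ Kx; rewrite /D !mulrDr.
  have [lx|lx] := ler0P (l x); have [lv'|lv'] := ler0P (l v); nra.
have sA x : closure A x -> 0 <= l x - s * phi x.
  move=> cx; have [->|x0] := eqVneq x 0; first by rewrite !lform0 mulr0 subr0.
  have [px|px] := leP 0 (phi x).
    have := sK _ (KZ _ cx x0 px).
    rewrite (lformZ l) (lformZ phi) mulrCA -mulrBr.
    by rewrite pmulr_rge0// invr_gt0 normr_gt0.
  (* For [phi x < 0], adding a multiple of [v] brings [x] into [phi = 0], where [l] is nonnegative,
     and [l - s * phi] only gets scaled because it vanishes at [v]. *)
  pose y := phi v *: x + (- phi x) *: v.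
  have cy : closure A y.
    apply: (closure_innerD sC); apply: (closure_innerZ sC) => //.
    by rewrite oppr_gt0.
  have ly : l y = phi v * (l x - s * phi x) by rewrite !(lformE l) lv; ring.
  have : 0 <= l y.
    have [->|y0] := eqVneq y 0; first by rewrite lform0.
    by rewrite ltW// lpos// !(lformE phi); ring.
  by rewrite ly pmulr_rge0.
exists s, v; split=> //.
apply/(strong_coneE sC); split=> //; last by apply/eqP; exact: Kn0.
move=> Av; have := open_form_gt0 oA _ (@pencil_neq0 l s li) Av.
rewrite pencilE lv subrr ltxx => H; have // : false; apply: H => a Aa.
by rewrite pencilE sA//; exact: subset_closure.
Qed.


(** * Refracting vectors of a single strong cone *)

Definition trace l := [set x | l x = 0] `&` [set x | phi x = 0].

Definition refracting l v :=
  [/\ C v, 0 <= phi v & trace l `<=` tangent_space C v].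

Lemma opp_continuous l : continuous l -> continuous (\- l).
Proof. by move=> lc x; apply: continuousN; exact: lc. Qed.

Lemma opp_independent l : independent l -> independent (\- l).
Proof.
move=> [[x lx px] [y py ly]]; split; first by exists x; rewrite //= lx oppr0.
by exists y; rewrite //= oppr_eq0.
Qed.

Lemma traceN l : trace (\- l) = trace l.
Proof.
by apply/seteqP; split=> x [/= lx px]; split=> //=; apply/eqP;
  move/eqP: lx; rewrite oppr_eq0.
Qed.

Lemma supported_refracting l s v : continuous l -> independent l ->
  supported l s v -> refracting l v.
Proof.
move=> lc li sv; have [Cv pv _ _] := sv; split => //; first exact: ltW.
by rewrite (supported_tangent lc li sv) => x [/= -> ->]; rewrite mulr0.
Qed.

Lemma refracting_form l v : independent l -> refracting l v ->
  exists a b : R, [/\ a * phi v + b * l v = 0,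
  forall x, A x -> 0 < a * phi x + b * l x &
  forall x, closure A x -> 0 <= a * phi x + b * l x].
Proof.
move=> li [Cv _ tv]; have [k [kc kE kv kA]] := cone_normal sC hC Cv.
rewrite kE in tv; have [a [b ab]] := independent_combination li tv.
exists a, b; split=> [|x|x cx]; rewrite -ab//; first exact: kA.
by apply: closure_ge0 cx => // y /kA/ltW.
Qed.

(** The inner normal at [v] is [a * phi + b * l]; dividing by |b| selects [l] or [- l] according to
    the sign of [b]. With [b = 0] and [phi v > 0] it would be zero. *)
Lemma refracting_supported l v : independent l -> refracting l v ->
  0 < phi v ->
  (exists s, supported l s v) \/ (exists s, supported (\- l) s v).
Proof.
move=> li rv pv; have [Cv _ _] := rv.
have [a [b [abv abA abc]]] := refracting_form li rv.
have [b0|b0|b0] := ltgtP b 0.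
- have bn0 : b != 0 by rewrite lt_eqF.
  right; exists (a / b); split => [//|//|/=|x cx /=].
    have -> : l v = (a * phi v + b * l v) / b - a / b * phi v by field.
    by rewrite abv mul0r sub0r opprK.
  have -> : - l x - a / b * phi x = - b^-1 * (a * phi x + b * l x) by field.
  by rewrite mulr_ge0 ?abc// oppr_ge0 invr_le0 ltW.
- have bn0 : b != 0 by rewrite gt_eqF.
  left; exists (- a / b); split => [//|//||x cx].
    have -> : l v = (a * phi v + b * l v) / b + - a / b * phi v by field.
    by rewrite abv mul0r add0r.
  have -> : l x - - a / b * phi x = b^-1 * (a * phi x + b * l x) by field.
  by rewrite mulr_ge0 ?abc// invr_ge0 ltW.
- have [y Ay] := cone_inner_neq0 sC Cv.
  have a0 : a = 0.
    by move/eqP: abv; rewrite b0 mul0r addr0 mulf_eq0 (gt_eqF pv) orbF => /eqP.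
  by have := abA _ Ay; rewrite b0 a0 !mul0r addr0 ltxx.
Qed.

Lemma refractingN l : refracting (\- l) = refracting l.
Proof. by rewrite /refracting traceN. Qed.

(** At [y] the form [- l - s * phi] is negative whatever [s] is; this rules out the second
    extremum. *)
Lemma supported_opp l y s v : closure A y -> phi y = 0 -> 0 < l y ->
  ~ supported (\- l) s v.
Proof.
by move=> cy py ly [_ _ _ /(_ _ cy)] /=; rewrite py; lra.
Qed.

Lemma transverse_unique l y v w : continuous l -> independent l ->
  closure A y -> phi y = 0 -> 0 < l y ->
  refracting l v -> refracting l w -> 0 < phi v -> 0 < phi w ->
  same_direction v w.
Proof.
move=> lc li cy py ly rv rw pv pw.
have [[s sv]|[s /(supported_opp cy py ly)//]] := refracting_supported li rv pv.
have [[t tw]|[t /(supported_opp cy py ly)//]] := refracting_supported li rw pw.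
exact: (supported_unique lc li sv tw).
Qed.

Lemma form_sign l y : continuous l -> independent l -> l y != 0 ->
  exists l', [/\ continuous l', independent l', refracting l' = refracting l,
    trace l' = trace l & 0 < l' y].
Proof.
move=> lc li; rewrite neq_lt => /orP[ly|ly]; last by exists l.
exists (\- l); split; [exact: opp_continuous|exact: opp_independent| | |].
- exact: refractingN.
- exact: traceN.
- by rewrite /= oppr_gt0.
Qed.

Lemma refracting_timelike l : continuous l -> independent l ->
  (exists2 c, C c & 0 < phi c) -> (exists2 a, A a & phi a = 0) ->
  (forall x, trace l x -> ~ A x /\ ~ C x) ->
  unique_direction (refracting l) /\ (forall v, refracting l v -> phi v <> 0).
Proof.
move=> lc li [c Cc pc] [a Aa pa] spl.
(* If [phi v = 0], the normal [p * phi + q * l] gives [q * l v = 0], and its positivity at [a] gives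
   [q] nonzero; then [v] would be a cone vector in the trace. *)
have tra v : refracting l v -> phi v <> 0.
  move=> rv pv; have [Cv _ _] := rv.
  have [p [q [e pA _]]] := refracting_form li rv.
  have := pA _ Aa; rewrite pa mulr0 add0r; move: e; rewrite pv mulr0 add0r.
  move/eqP; rewrite mulf_eq0 => /orP[/eqP ->|/eqP lv].
    by rewrite mul0r ltxx.
  by case: (spl v) => // _ [].
have la : l a != 0 by apply/eqP => la; case: (spl a) => // [].
have [l' [lc' li' rE tE la']] := form_sign lc li la.
rewrite -rE in tra *; rewrite -tE in spl; move: lc' li' la' {lc li la rE tE}.
move: l' tra spl => {}l tra spl lc li la.
have pos x : closure A x -> x != 0 -> phi x = 0 -> 0 < l x.
  move=> cx x0 px; rewrite ltNge le_eqVlt; apply/negP => /orP[/eqP lx|lx].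
    have [nA nC] := spl x (conj lx px).
    by have [//|//|x00] := closure_innerE sC cx; rewrite x00 eqxx in x0.
  (* If [l] were negative at [x], this positive combination would be a vector of [A] in the
     trace. *)
  pose y := (- l x) *: a + l a *: x.
  have Ay : A y.
    apply: (inner_closureD sC).
      by apply: (inner_cone sC) => //; rewrite oppr_gt0.
    exact: (closure_innerZ sC cx la).
  case: (spl y) => //; split=> /=; rewrite /y.
    by rewrite !(lformE l); ring.
  by rewrite !(lformE phi) pa px !mulr0 addr0.
have [s [v sv]] : exists s v, supported l s v.
  by apply: supported_exists => //; exists c => //; exact: (cone_closure sC Cc).
split=> //; split; first by exists v; exact: (supported_refracting lc li sv).
have pp z : refracting l z -> 0 < phi z.
  move=> rz; have [_ pz _] := rz; rewrite lt_neqAle pz andbT eq_sym.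
  by apply/eqP; exact: tra.
move=> z w rz rw.
by apply: (transverse_unique lc li (subset_closure Aa) pa la) => //; exact: pp.
Qed.

(** The tangent hyperplane of every refracting vector contains the trace, hence [w], and by strict
    convexity the vector is then a multiple of [w]. *)
Lemma refracting_trace_lightlike l w : C w -> trace l w ->
  trace l `<=` tangent_space C w ->
  unique_direction (refracting l) /\ (forall v, refracting l v -> phi v = 0).
Proof.
move=> Cw tw tt; have [_ /= pw] := tw.
have rw : refracting l w by split; rewrite // pw.
have dir v : refracting l v -> same_direction v w.
  by move=> [Cv _ /(_ _ tw)]; exact: (cone_strictly_convex sC hC Cv Cw).
split; last first.
  move=> v /dir[a a0]; move=> wE; move/eqP: pw; rewrite wE (lformZ phi).
  by rewrite mulf_eq0 gt_eqF//= => /eqP.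
split; first by exists w.
move=> v z /dir[a a0 wa] /dir[b b0 wb]; exists (b^-1 * a).
  by rewrite mulr_gt0// invr_gt0.
by rewrite -scalerA -wa wb scalerA mulVf ?scale1r// gt_eqF.
Qed.

Lemma refracting_trace_timelike l v a : A a -> trace l a -> ~ refracting l v.
Proof.
move=> Aa ta [Cv _ /(_ _ ta)].
have [k [_ -> _ kA]] := cone_normal sC hC Cv.
by apply/eqP; rewrite gt_eqF// kA.
Qed.

(** [phi] is proportional to the inner normal at [w], and [c] fixes the sign of the factor. *)
Lemma tangent_phi_gt0 w c : C w -> [set x | phi x = 0] `<=` tangent_space C w ->
  C c -> 0 < phi c -> forall a, A a -> 0 < phi a.
Proof.
move=> Cw Tw Cc pc a Aa; have [k [kc kE kw kA]] := cone_normal sC hC Cw.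
rewrite kE in Tw.
have [q q0 kq] : exists2 q : R, q != 0 & forall x, k x = q * phi x.
  by apply: ker_sub_proportional => //; exists a; rewrite gt_eqF// kA.
have kc0 : 0 <= k c.
  apply: closure_ge0 (cone_closure sC Cc) => // x /kA; exact: ltW.
have {}q0 : 0 < q.
  by move: kc0; rewrite kq pmulr_lge0// le_eqVlt eq_sym (negbTE q0).
by have := kA _ Aa; rewrite kq pmulr_rgt0.
Qed.

(** The closed cone meets [phi = 0] in the ray of [w] only, so orienting [l] by [l w > 0] is enough
    for the minimization; [w] is the tangent solution. *)
Lemma refracting_tangent l w : continuous l -> independent l ->
  (exists2 c, C c & 0 < phi c) ->
  C w -> phi w = 0 -> [set x | phi x = 0] `<=` tangent_space C w ->
  (forall x, trace l x -> ~ A x /\ ~ C x) ->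
  exactly_two_directions (refracting l) /\
  exists v w, [/\ refracting l v, refracting l w, phi v = 0 & phi w <> 0].
Proof.
move=> lc li [c Cc pc] Cw pw Tw spl.
have pA := tangent_phi_gt0 Cw Tw Cc pc.
have lw : l w != 0 by apply/eqP => lw; case: (spl w) => // _ [].
have [l' [lc' li' rE tE lw']] := form_sign lc li lw.
rewrite -rE; rewrite -tE in spl; move: lc' li' lw' {lc li lw rE tE}.
move: l' spl => {}l spl lc li lw.
have dir x : C x -> phi x = 0 -> same_direction w x.
  by move=> Cx px; apply: (cone_strictly_convex sC hC) => //; exact: Tw.
have pos x : closure A x -> x != 0 -> phi x = 0 -> 0 < l x.
  move=> cx x0 px; have [/pA|Cx|x00] := closure_innerE sC cx.
  - by rewrite px ltxx.
  - by have [t t0 ->] := dir _ Cx px; rewrite (lformZ l) mulr_gt0.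
  - by rewrite x00 eqxx in x0.
have [s [v sv]] : exists s v, supported l s v.
  by apply: supported_exists => //; exists c => //; exact: (cone_closure sC Cc).
have rv := supported_refracting lc li sv; have [_ pv _ _] := sv.
have rw : refracting l w.
  by split; rewrite ?pw// => x [_ px]; exact: Tw.
split; last by exists w, v; split => //; apply/eqP; rewrite gt_eqF.
exists w, v; split=> //.
  by move=> [t t0 vE]; move: pv; rewrite vE (lformZ phi) pw mulr0 ltxx.
move=> z rz; have [Cz pz _] := rz; have [pz0|pz0] := eqVneq (phi z) 0.
  by left; exact: dir.
right; apply: (transverse_unique lc li (cone_closure sC Cw) pw lw) => //.
by rewrite lt_neqAle eq_sym pz0.
Qed.

Lemma refracting_spacelike l : continuous l -> independent l ->
  (exists2 c, C c & 0 < phi c) -> (forall x, phi x = 0 -> ~ A x /\ ~ C x) ->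
  exactly_two_directions (refracting l) /\
  (forall v, refracting l v -> phi v <> 0).
Proof.
move=> lc li [c Cc pc] spl.
have tra v : refracting l v -> phi v <> 0 by move=> [Cv _ _] /spl[].
have pos (k : {linear V -> R}) x :
    closure A x -> x != 0 -> phi x = 0 -> 0 < k x.
  move=> cx x0 /spl[nA nC]; have [//|//|x00] := closure_innerE sC cx.
  by rewrite x00 eqxx in x0.
have ec : exists2 c, closure A c & 0 < phi c.
  by exists c => //; exact: (cone_closure sC Cc).
have nc := opp_continuous lc; have ni := opp_independent li.
have [s [v sv]] := supported_exists lc li (pos _) ec.
have [t [w tw]] := supported_exists nc ni (pos _) ec.
split=> //; exists v, w; split.
- exact: (supported_refracting lc li sv).
- by rewrite -refractingN; exact: (supported_refracting nc ni tw).
(* If the two extrema shared a direction, then [t = - s], and [l - s * phi] would be both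
   nonpositive and positive on [A]. *)
- move=> [a a0 wE]; have [Cv pv lv lA] := sv; have [_ pw /= lw nlA] := tw.
  have ts : t = - s.
    have : (t + s) * (a * phi v) = 0.
      by move: lw; rewrite wE (lformZ l) (lformZ phi) lv; lra.
    move/eqP; rewrite !mulf_eq0 (gt_eqF a0) (gt_eqF pv) !orbF addr_eq0.
    by move=> /eqP.
  have [y Ay] := cone_inner_neq0 sC Cv.
  have := open_form_gt0 oA _ (@pencil_neq0 l s li) Ay; rewrite pencilE => H.
  have : 0 < l y - s * phi y.
    by apply: H => x Ax; rewrite pencilE lA//; exact: subset_closure.
  by have := nlA _ (subset_closure Ay); rewrite /= ts; lra.
- move=> z rz; have pz : 0 < phi z.
    have [_ pz _] := rz; rewrite lt_neqAle pz andbT eq_sym.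
    by apply/eqP; exact: tra.
  have [[s' sz]|[t' tz]] := refracting_supported li rz pz; [left|right].
    exact: (supported_unique lc li sv sz).
  exact: (supported_unique nc ni tw tz).
Qed.

Lemma no_crossing_tangent l v : (exists x, phi x != 0) ->
  (forall x, C x -> ~ 0 < phi x) -> refracting l v ->
  tangent_space C v = [set x | phi x = 0].
Proof.
move=> [x0 px0] nC [Cv pv _].
have {}pv : phi v = 0.
  by apply/eqP; rewrite eq_le pv andbT leNgt; apply/negP; exact: nC.
have pA a : A a -> phi a <= 0.
  move=> Aa; rewrite leNgt; apply/negP => pa.
  (* Moving along [- v] keeps [phi] constant. Staying in [A] forever would put [- v] in the closure,
     against pointedness; leaving [A] gives a point of [C] with [phi > 0]. *)
  have [H|[t [t0 nA]]] : (forall t, 0 < t -> A (a - t *: v)) \/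
      (exists t, 0 < t /\ ~ A (a - t *: v)).
    apply: contrapT => /not_orP[H1 H2]; apply: H1 => t t0.
    apply: contrapT => nA.
    by apply: H2; exists t.
  - suff cv : closure A (- v).
      have := cone_neq0 sC Cv.
      by rewrite (closure_inner_pointed sC (cone_closure sC Cv) cv) eqxx.
    apply/closure_ballP => e e0; have a1 : 0 < `|a| + 1 by rewrite ltr_wpDl.
    pose t := (`|a| + 1) / e; have t0 : 0 < t by rewrite divr_gt0.
    exists (t^-1 *: (a - t *: v)).
      by apply: (inner_cone sC); [exact: H|rewrite invr_gt0].
    rewrite (_ : _ - _ = t^-1 *: a); last by lmodule; field; rewrite gt_eqF.
    rewrite normrZ gtr0_norm ?invr_gt0// /t invf_div mulrAC ltr_pdivrMr//.
    by rewrite ltr_pM2l// ltrDl.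
  - have [s _ [cz nz]] := boundary_segment oA Aa nA.
    move: cz nz; set z := a + s *: _ => cz nz.
    have pz : 0 < phi z by rewrite !(lformE phi) pv; lra.
    apply: (nC z) => //; apply/(strong_coneE sC).
    split=> [||z0] //.
    by rewrite z0 lform0 ltxx in pz.
have nphi x : (\- phi : {linear V -> R}) x = - phi x by [].
rewrite (support_tangentE sC hC Cv (opp_continuous phic)).
- apply/seteqP; split=> x /= => [/eqP|->]; last by rewrite oppr0.
  by rewrite oppr_eq0 => /eqP.
- by move=> a Aa; rewrite nphi oppr_ge0 pA.
- by exists x0; rewrite nphi oppr_eq0.
- by rewrite nphi pv oppr0.
Qed.

End Refraction.

(** * The theorem at a point of the interface *)

Lemma cone_structure_fiber (R : realType) (m : nat) (Q : smoothManifold R m)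
    (D : set Q) (C : coneStructure D) (p : Q) : D p ->
  strong_cone (cone C p) (inner C p) /\ hypersurface (cone C p).
Proof.
(* Regularity up to the boundary of [D] is that of the extension to the open set [U], whose fiber at
   [p] is the same. *)
move=> Dp; have [U [K [I [_ DU KU KI]]]] := cone_extendable C.
have [<- <-] := KI _ Dp; split; first exact: (cone_on_fiber KU (DU _ Dp)).
exact: (fiber_hypersurface KU (DU _ Dp)).
Qed.

Lemma ker_sub_eq (R : realType) (E : normedModType R) (k l : {linear E -> R}) :
  (exists x, k x != 0) -> [set x | l x = 0] `<=` [set x | k x = 0] ->
  [set x | l x = 0] = [set x | k x = 0].
Proof.
move=> kn lk; have [c c0 kE] := ker_sub_proportional kn lk.
apply/seteqP; split=> // x /= /eqP; rewrite kE mulf_eq0 (negbTE c0).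
by move=> /eqP.
Qed.

Lemma ker_neq_independent (R : realType) m (phi l : {linear 'rV[R]_m -> R}) :
  (exists x, phi x != 0) -> (exists x, l x != 0) ->
  [set x | l x = 0] <> [set x | phi x = 0] -> independent phi l.
Proof.
move=> phin ln neq; split; apply: contrapT => H.
  apply: neq; apply: ker_sub_eq => // x lx; apply: contrapT => /eqP px.
  by apply: H; exists x.
apply/neq/esym; apply: ker_sub_eq => // x px; apply: contrapT => /eqP lx.
by apply: H; exists x.
Qed.

Theorem theorem5p6 (R : realType) (n : nat) (hn : (3 <= n.+1)%N)
  (Q : smoothManifold R n.+1) (eta Q1 Q2 : set Q)
  (hdiv : divides eta Q1 Q2)
  (C1 : coneStructure (closure Q1)) (C2 : coneStructure (closure Q2))
  (p : Q) (hp : eta p) (u : 'rV[R]_n.+1) (hu : incident eta Q2 C1 p u) :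
  let T := mtangent_space eta p in
  let Pi := perp_trace eta p C1 u in
  let refr := refracted eta C1 C2 p u in
  let crossing := cone C2 p `&` side_halfspace eta Q2 p in
  (perp C1 p u <> T -> crossing !=set0 ->
     [/\ timelike_subspace C2 p T ->
         [/\ spacelike_subspace C2 p Pi ->
               unique_direction refr /\ (forall v, refr v -> ~ T v),
             lightlike_subspace C2 p Pi ->
               unique_direction refr /\ (forall v, refr v -> T v)
           & timelike_subspace C2 p Pi -> ~ exists v, refr v],
         lightlike_subspace C2 p T ->
         [/\ ~ timelike_subspace C2 p Pi,
             spacelike_subspace C2 p Pi ->
               exactly_two_directions refr /\
               exists v w, [/\ refr v, refr w, T v & ~ T w]
           & lightlike_subspace C2 p Pi ->
               unique_direction refr /\ (forall v, refr v -> T v)]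
       & spacelike_subspace C2 p T ->
           exactly_two_directions refr /\ (forall v, refr v -> ~ T v)]) /\
  (perp C1 p u = T \/ crossing = set0 ->
     [/\ (exists v, refr v) <-> lightlike_subspace C2 p T,
         at_most_one_direction refr
       & forall v, refr v -> T v]).
Proof.
move=> T Pi refr crossing.
have [D2p [phi [phic phin TE sideE]]] :=
  boundary_form hp (divides_domain2 hdiv).
have [D1p _] := boundary_form hp (divides_domain1 hdiv).
have [sC1 hC1] := cone_structure_fiber C1 D1p.
have [sC hC] := cone_structure_fiber C2 D2p.
have [Cu _] := hu; have [l [lc perpE lu lA]] := cone_normal sC1 hC1 Cu.
have ln : exists x, l x != 0.
  by have [a /lA la] := cone_inner_neq0 sC1 Cu; exists a; rewrite gt_eqF.
have TphiE : T = [set x | phi x = 0] by exact: TE.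
have perplE : perp C1 p u = [set x | l x = 0] by exact: perpE.
have PiE : Pi = trace phi l by rewrite /Pi /perp_trace perplE -/T TphiE.
have refrE : refr = refracting (cone C2 p) phi l.
  apply/seteqP; split=> v.
    move=> [Cv sv tv]; split=> //.
      by move: sv; rewrite sideE -/T TphiE /= => -[/ltW//|->].
    by rewrite -PiE => x /tv[].
  move=> [Cv pv tv]; split; first exact: Cv.
    rewrite sideE -/T TphiE /=; move: pv; rewrite le_eqVlt => /orP[/eqP pv|pv].
      by right.
    by left.
  rewrite -/Pi => x Pix; split; [|exact: Pix.2].
  by apply: tv; rewrite -PiE.
have spacelikeP (P : set 'rV[R]_n.+1) : spacelike_subspace C2 p P ->
    forall x, P x -> ~ inner C2 p x /\ ~ cone C2 p x.
  by move=> sp x /sp[nc _]; split=> H; apply: nc; [left|right].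
have TP x : T x <-> phi x = 0 by rewrite TphiE.
rewrite refrE PiE; split.
  move=> neq [c [Cc sc]].
  have pc : 0 < phi c by move: sc; rewrite sideE.
  have ec : exists2 c, cone C2 p c & 0 < phi c by exists c.
  have li : independent phi l.
    by apply: ker_neq_independent => //; rewrite -TphiE -perplE.
  split.
  - move=> [a [/TP pa Aa]].
    have ea : exists2 a, inner C2 p a & phi a = 0 by exists a.
    split=> [/spacelikeP spl|[w [Cw tw tt]]|[x [tx Ax]] [v]].
    + have [H1 H2] := refracting_timelike sC hC phic lc li ec ea spl.
      by split=> // v /H2 + /TP.
    + have [H1 H2] := refracting_trace_lightlike sC hC Cw tw tt.
      by split=> // v /H2 /TP.
    + exact: (refracting_trace_timelike sC hC Ax tx).
  - move=> [w [Cw /TP pw Tw]]; have {}Tw : [set x | phi x = 0] `<=`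
      tangent_space (cone C2 p) w by move=> x px; apply: Tw; apply/TP.
    split=> [[x [[_ /= px] Ax]]|/spacelikeP spl|[y [Cy ty tt]]].
    + by have := tangent_phi_gt0 sC hC Cw Tw Cc pc Ax; rewrite px ltxx.
    + have [H1 [v [z [rv rz pv pz]]]] :=
        refracting_tangent sC hC phic lc li ec Cw pw Tw spl.
      by split=> //; exists v, z; split=> //; [apply/TP|move/TP].
    + have [H1 H2] := refracting_trace_lightlike sC hC Cy ty tt.
      by split=> // v /H2 /TP.
  - move=> /spacelikeP spl.
    have {}spl x : phi x = 0 -> ~ inner C2 p x /\ ~ cone C2 p x.
      by move=> /TP; exact: spl.
    have [H1 H2] := refracting_spacelike sC hC phic lc li ec spl.
    by split=> // v /H2 + /TP.
move=> deg.
(* In both degenerate cases a refracted vector has [T] as its tangent hyperplane: when [perp C1 p u]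
   is [T] the trace is all of [T], and when nothing crosses, [\- phi] supports the cone at [v]. *)
have tanE v : refracting (cone C2 p) phi l v ->
    tangent_space (cone C2 p) v = [set x | phi x = 0].
  case: deg => [perpT|nc] rv; last first.
    apply: (no_crossing_tangent sC hC phic phin) rv => x Cx px.
    have : crossing x by split=> //; rewrite sideE.
    by rewrite nc.
  have [Cv _ tv] := rv; have [k [_ kE _ kA]] := cone_normal sC hC Cv.
  rewrite kE; apply/esym/ker_sub_eq.
    by have [a /kA ka] := cone_inner_neq0 sC Cv; exists a; rewrite gt_eqF.
  rewrite -kE => x px; apply: tv; split=> //.
  by rewrite -perplE perpT TphiE.
(* The radial direction makes [v] belong to its own tangent hyperplane, which is [T]. *)
have rT v : refracting (cone C2 p) phi l v -> phi v = 0.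
  move=> rv; have [Cv _ _] := rv; have [k [_ kE kv _]] := cone_normal sC hC Cv.
  have : tangent_space (cone C2 p) v v by rewrite kE.
  by rewrite tanE.
split.
- split=> [[v rv]|[w [Cw /TP pw Tw]]].
    have [Cv _ _] := rv; exists v; split=> //; first exact/TP/rT.
    by move=> x /TP px; rewrite /perp (tanE v rv).
  exists w; split=> //; first by rewrite pw.
  by move=> x [_ px]; apply: Tw; apply/TP.
- move=> v w rv rw; have [Cv _ _] := rv; have [Cw _ _] := rw.
  by apply: (cone_strictly_convex sC hC) => //; rewrite tanE//; exact: rT.
- by move=> v rv; apply/TP/rT.
Qed.
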